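(* Let $\Gamma$ be a graph. Then $\Gamma$ is hyperbolic if and only if $\operatorname{sCop}(\Gamma)=1$.
   Context: A geodesic metric space is hyperbolic if there exists $\delta$ such that all geodesic triangles are $\delta$-slim, i.e. for any geodesics $[x,y],[y,z],[x,z]$ one has $[x,z]\subseteq N_\delta([x,y]\cup[y,z])$. A graph is hyperbolic if it is so as a geodesic metric space with edges of length one. Convention: $\mathbb{N}=\mathbb{Z}_{\geq 1}$. Graphs are connected, undirected, without double edges or loops, with the path metric on vertices. Game. Let $\Gamma$ be a graph. The cops and robbers game on $\Gamma$ has parameters: number of cops $n\in\mathbb{N}$, base point (treasure) $v\in\Gamma$ a vertex, cop speed $\sigma\in\mathbb{N}$, robber speed $\psi\in\mathbb{N}$, cop reach $\rho\in\mathbb{N}$, robber radius $R\in\mathbb{N}$. It is a two-player game with perfect information. First the cop player chooses $n$ vertices as starting positions of the cops, then the robber chooses a vertex as starting position. The players then alternate turns, starting with the cops. In each turn the cop player may move each cop along a path of length at most $\sigma$ to some vertex; then the robber moves along a path of length at most $\psi$ ending in a vertex. One cop move followed by one robber move is a stage. The cop player wins if the robber is captured, i.e. at some time during some stage the robber's position is at distance at most $\rho$ from some cop's position (this includes every vertex traversed by the robber during a move: the robber must traverse the path edge by edge without ever coming within distance $\rho$ of a cop), or if the cops eventually defend $v$, i.e. after some finite initial time the robber never enters the closed ball of radius $R$ around $v$. Otherwise the robber wins. The strong cop number $\operatorname{sCop}(\Gamma)\in\mathbb{N}\cup\{\infty\}$ is the infimum (with $\inf\emptyset=\infty$) of all $n\in\mathbb{N}$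 such that $\forall v\in\Gamma,\ \exists\sigma\in\mathbb{N},\ \forall\psi\in\mathbb{N},\ \exists\rho\in\mathbb{N},\ \forall R\in\mathbb{N}$: the cop player has a winning strategy with $n$ cops. *)

(* Defs.v *)
From Stdlib Require Import Reals Lra Lia List.
From Stdlib Require Fin.
From Stdlib Require Import ClassicalEpsilon FunctionalExtensionality ProofIrrelevance.
From Coquelicot Require Import Rbar Lub.
Import ListNotations.

Set Implicit Arguments.
Open Scope R_scope.

(* [is_path adj u p] : the edge path starting at [u] and then visiting the
   vertices of [p] in order; its length is [length p], its end is [last p u]. *)
Fixpoint is_path (V : Type) (adj : V -> V -> Prop) (u : V) (p : list V) : Prop :=
  match p with
  | [] => True
  | w :: p' => adj u w /\ is_path adj w p'
  end.

(* Symmetric and irreflexive: undirected, no loops, no double edges.  No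
   finiteness or local finiteness is assumed. *)
Record graph : Type := Graph {
  vertex :> Type;
  adj : vertex -> vertex -> Prop;
  adj_sym : forall u v, adj u v -> adj v u;
  adj_irrefl : forall u, ~ adj u u;
  connected : forall u v, exists p, is_path adj u p /\ last p u = v
}.
Arguments adj {g} u v.

(* The path metric is the minimal length of a path, so this says d(u,v) <= k. *)
Definition within (G : graph) (k : nat) (u v : G) : Prop :=
  exists p, is_path adj u p /\ last p u = v /\ (length p <= k)%nat.

(* [g] restricted to [0, d(x,y)] is an isometric embedding from x to y. *)
Definition geodesic (X : Metric_Space) (x y : Base X) (g : R -> Base X) : Prop :=
  g 0 = x /\ g (dist X x y) = y /\
  forall s t, 0 <= s <= dist X x y -> 0 <= t <= dist X x y ->
    dist X (g s) (g t) = Rabs (s - t).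

(* Closed rather than open neighbourhoods: immaterial below, where delta is
   existentially quantified. *)
Definition near_geodesic (X : Metric_Space) (delta : R)
    (x y : Base X) (g : R -> Base X) (p : Base X) : Prop :=
  exists t, 0 <= t <= dist X x y /\ dist X p (g t) <= delta.

(* Meant for geodesic spaces; the realization of a connected graph is one. *)
Definition hyperbolic (X : Metric_Space) : Prop :=
  exists delta : R,
  forall (x y z : Base X) (gxy gyz gxz : R -> Base X),
    geodesic X x y gxy -> geodesic X y z gyz -> geodesic X x z gxz ->
    forall s, 0 <= s <= dist X x z ->
      near_geodesic X delta x y gxy (gxz s) \/
      near_geodesic X delta y z gyz (gxz s).

(* Points of the geometric realization are given by barycentric coordinates.  On the closed edge [u,v], the
   coordinate at [v] is the distance to [u]. *)
Definition is_vertex_coord (G : graph) (u : G) (x : G -> R) : Prop :=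
  x u = 1 /\ forall w, w <> u -> x w = 0.

Definition on_edge (G : graph) (u v : G) (x : G -> R) : Prop :=
  adj u v /\ 0 <= x u /\ 0 <= x v /\ x u + x v = 1 /\
  forall w, w <> u -> w <> v -> x w = 0.

(* The first alternative only matters for the graph with a single vertex. *)
Record point (G : graph) : Type := Point {
  coord :> G -> R;
  coord_spec : (exists u, is_vertex_coord G u coord) \/
               (exists u v, on_edge G u v coord)
}.

(* Chains of segments each contained in a closed edge, with their length. *)
Inductive chain (G : graph) : point G -> point G -> R -> Prop :=
| chain_nil : forall x, chain x x 0
| chain_cons : forall (u v : G) (x y z : point G) (l : R),
    on_edge G u v x -> on_edge G u v y -> chain y z l ->
    chain x z (Rabs (x u - y u) + l).

Definition length_dist (G : graph) (x y : point G) : R :=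
  real (Glb_Rbar (chain x y)).

Section RealizationIsMetric.
Variable G : graph.
Implicit Types x y z : point G.

Lemma point_eq x y : (forall w, x w = y w) -> x = y.
Proof.
  destruct x as [x hx], y as [y hy]; simpl; intros H.
  assert (x = y) by (apply functional_extensionality; exact H). subst y.
  f_equal; apply proof_irrelevance.
Qed.

Lemma chain_app x y z l l' : chain x y l -> chain y z l' -> chain x z (l + l').
Proof.
  intros H; revert z l'; induction H; intros z' l' H'.
  - now rewrite Rplus_0_l.
  - rewrite Rplus_assoc. eapply chain_cons; eauto.
Qed.

Lemma chain_sym x y l : chain x y l -> chain y x l.
Proof.
  induction 1 as [|u v x y z l Hx Hy _ IH]; [constructor|].
  rewrite Rplus_comm. apply (chain_app IH).
  rewrite Rabs_minus_sym, <- (Rplus_0_r (Rabs _)).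
  eapply chain_cons; eauto. constructor.
Qed.

Lemma chain_coord x y l w : chain x y l -> Rabs (x w - y w) <= l.
Proof.
  induction 1 as [x|u v x y z l Hx Hy _ IH].
  - rewrite Rminus_diag, Rabs_R0. lra.
  - assert (Rabs (x w - y w) <= Rabs (x u - y u)).
    { destruct Hx as (_ & _ & _ & sx & zx), Hy as (_ & _ & _ & sy & zy).
      destruct (classic (w = u)) as [->|nu]; [lra|].
      destruct (classic (w = v)) as [->|nv].
      - replace (x v - y v) with (- (x u - y u)) by lra. rewrite Rabs_Ropp; lra.
      - rewrite zx, zy, Rminus_diag, Rabs_R0 by assumption. apply Rabs_pos. }
    replace (x w - z w) with ((x w - y w) + (y w - z w)) by ring.
    eapply Rle_trans; [apply Rabs_triang|]. lra.
Qed.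

Definition vertex_coord (u w : G) : R :=
  if excluded_middle_informative (w = u) then 1 else 0.

Lemma vertex_coordP u : is_vertex_coord G u (vertex_coord u).
Proof.
  unfold vertex_coord; split.
  - destruct excluded_middle_informative; tauto.
  - intros w Hw; destruct excluded_middle_informative; tauto.
Qed.

Definition vertex_point (u : G) : point G :=
  {| coord := vertex_coord u;
     coord_spec := or_introl (ex_intro _ u (vertex_coordP u)) |}.

Lemma vertex_on_edge u v : adj u v ->
  on_edge G u v (vertex_point u) /\ on_edge G u v (vertex_point v).
Proof.
  intros a. assert (u <> v) by (intros ->; now apply (adj_irrefl G v)).
  destruct (vertex_coordP u) as [u1 u0], (vertex_coordP v) as [v1 v0].
  unfold on_edge; simpl; rewrite u1, v1, (u0 v), (v0 u) by congruence.
  repeat split; auto; lra.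
Qed.

Lemma chain_to_vertex x : exists u l, chain x (vertex_point u) l.
Proof.
  destruct (coord_spec x) as [[u [u1 u0]]|[u [v H]]].
  - exists u, 0. replace (vertex_point u) with x; [constructor|].
    apply point_eq; intros w; simpl. destruct (vertex_coordP u) as [e1 e0].
    destruct (classic (w = u)) as [->|n]; [now rewrite u1, e1|now rewrite u0, e0].
  - exists u; eexists. eapply chain_cons; [exact H| |apply chain_nil].
    apply vertex_on_edge, (proj1 H).
Qed.

Lemma chain_vertices u v : exists l, chain (vertex_point u) (vertex_point v) l.
Proof.
  destruct (connected G u v) as [p [Hp <-]]; revert u Hp.
  induction p as [|w p IH]; intros u; simpl.
  - intros _; exists 0; constructor.
  - intros [a Hp]. destruct (IH w Hp) as [l Hl]. eexists.
    eapply chain_cons; [apply (vertex_on_edge u w a)|apply (vertex_on_edge u w a)|].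
    replace (match p with [] => w | _ :: _ => last p u end) with (last p w); [exact Hl|].
    clear; destruct p as [|a p]; [reflexivity|].
    revert a; induction p as [|b p IH]; intros a; [reflexivity|apply IH].
Qed.

Lemma chain_exists x y : exists l, chain x y l.
Proof.
  destruct (chain_to_vertex x) as (u & a & Ha), (chain_to_vertex y) as (v & b & Hb),
    (chain_vertices u v) as (c & Hc).
  exists (a + (c + b)). eauto using chain_app, chain_sym.
Qed.

Lemma length_dist_glb x y : is_glb_Rbar (chain x y) (length_dist x y).
Proof.
  unfold length_dist. pose proof (Glb_Rbar_correct (chain x y)) as H.
  destruct (chain_exists x y) as [l Hl]. destruct (coord_spec x) as [[w _]|[w _]];
  (destruct (Glb_Rbar (chain x y)) as [r| |]; simpl in *;
  [exact H|destruct (proj1 H l Hl)|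
   destruct (proj2 H (Finite 0)); intros k Hk; simpl;
   eapply Rle_trans; [apply Rabs_pos|apply (chain_coord w Hk)]]).
Qed.

Lemma length_dist_le x y l : chain x y l -> length_dist x y <= l.
Proof. exact (proj1 (length_dist_glb x y) l). Qed.

Lemma le_length_dist x y r : (forall l, chain x y l -> r <= l) -> r <= length_dist x y.
Proof. exact (proj2 (length_dist_glb x y) (Finite r)). Qed.

Lemma length_dist_pos x y : length_dist x y >= 0.
Proof.
  apply Rle_ge, le_length_dist; intros l Hl.
  destruct (coord_spec x) as [[w _]|[w _]];
  (eapply Rle_trans; [apply Rabs_pos|apply (chain_coord w Hl)]).
Qed.

Lemma length_dist_sym x y : length_dist x y = length_dist y x.
Proof.
  apply Rle_antisym; apply le_length_dist; intros l Hl;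
  now apply length_dist_le, chain_sym.
Qed.

Lemma length_dist_refl x y : length_dist x y = 0 <-> x = y.
Proof.
  split.
  - intros H; apply point_eq; intros w.
    assert (Hw : Rabs (x w - y w) <= length_dist x y)
      by (apply le_length_dist; intros l; apply chain_coord).
    rewrite H in Hw. revert Hw; unfold Rabs; destruct Rcase_abs; lra.
  - intros <-. apply Rle_antisym; [apply length_dist_le; constructor|].
    apply Rge_le, length_dist_pos.
Qed.

Lemma length_dist_tri x y z : length_dist x y <= length_dist x z + length_dist z y.
Proof.
  cut (length_dist x y - length_dist z y <= length_dist x z); [lra|].
  apply le_length_dist; intros l Hl.
  cut (length_dist x y - l <= length_dist z y); [lra|].
  apply le_length_dist; intros l' Hl'.
  pose proof (length_dist_le (chain_app Hl Hl')). lra.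
Qed.

End RealizationIsMetric.

Definition realization (G : graph) : Metric_Space :=
  Build_Metric_Space (point G) (@length_dist G) (@length_dist_pos G)
    (@length_dist_sym G) (@length_dist_refl G) (@length_dist_tri G).

Definition hyperbolic_graph (G : graph) : Prop := hyperbolic (realization G).

(* A play of the robber: a starting vertex and, for each stage, the path
   followed, given by the successive vertices after the current one. *)
Record robber_play (G : graph) : Type := RobberPlay {
  robber_start : G;
  robber_move : nat -> list G
}.

Fixpoint robber_pos (G : graph) (r : robber_play G) (k : nat) : G :=
  match k with
  | O => robber_start r
  | S k' => last (robber_move r k') (robber_pos r k')
  end.

Definition legal_robber (G : graph) (psi : nat) (r : robber_play G) : Prop :=
  forall k, is_path adj (robber_pos r k) (robber_move r k) /\
            (length (robber_move r k) <= psi)%nat.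

(* The vertices at which the robber is at some time of stage [k] (counting
   from 0), including the one where it stands when the cops have just moved. *)
Definition robber_at (G : graph) (r : robber_play G) (k : nat) (w : G) : Prop :=
  In w (robber_pos r k :: robber_move r k).

(* A strategy for [n] cops: starting positions, and the next positions as a
   function of all choices made so far by the robber (its starting vertex and
   the list of its moves); the earlier cop positions are determined by these. *)
Record cop_strategy (G : graph) (n : nat) : Type := CopStrategy {
  cop_start : Fin.t n -> G;
  cop_next : G -> list (list G) -> Fin.t n -> G
}.

(* Position of the cops after their [k]-th move, against the play [r]. *)
Definition cop_pos (G : graph) (n : nat) (S : cop_strategy G n)
    (r : robber_play G) (k : nat) : Fin.t n -> G :=
  match k with
  | O => cop_start S
  | Datatypes.S k' => cop_next S (robber_start r) (map (robber_move r) (seq 0 k'))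
  end.

Definition legal_cops (G : graph) (n sigma psi : nat) (S : cop_strategy G n) : Prop :=
  forall r, legal_robber psi r ->
  forall k i, within G sigma (cop_pos S r k i) (cop_pos S r (k + 1) i).

(* During stage [k] the cops stand where their move number [k + 1] put them. *)
Definition captured (G : graph) (n rho : nat) (S : cop_strategy G n)
    (r : robber_play G) : Prop :=
  exists k w i, robber_at r k w /\ within G rho (cop_pos S r (k + 1) i) w.

Definition defended (G : graph) (v : G) (rad : nat) (r : robber_play G) : Prop :=
  exists N, forall k w, (N <= k)%nat -> robber_at r k w -> ~ within G rad v w.

Definition cops_win (G : graph) (n : nat) (v : G) (sigma psi rho rad : nat) : Prop :=
  exists S : cop_strategy G n, legal_cops sigma psi S /\
    forall r, legal_robber psi r -> captured rho S r \/ defended v rad r.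

Definition strong_cops_win (G : graph) (n : nat) : Prop :=
  forall v : G,
  exists sigma, (1 <= sigma)%nat /\
  forall psi, (1 <= psi)%nat ->
  exists rho, (1 <= rho)%nat /\
  forall rad, (1 <= rad)%nat ->
  cops_win G n v sigma psi rho rad.

(* The infimum, with value [p_infty] if no number of cops suffices. *)
Definition sCop (G : graph) : Rbar :=
  Glb_Rbar (fun x => exists n : nat, (1 <= n)%nat /\ strong_cops_win G n /\ x = INR n).

(* Main.v *)
Require Import Defs.
From Stdlib Require Import Reals Lra Lia List ZArith Wf_nat.
From Stdlib Require Fin.
From Stdlib Require Import ClassicalEpsilon.
From Coquelicot Require Import Rcomplements Rbar Lub.
Import ListNotations.
Local Open Scope nat_scope.

Set Implicit Arguments.
Unset Strict Implicit.

(** The infimum is 1 exactly when one cop suffices, so the claim is that one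
    cop wins if and only if the graph is hyperbolic.

    If the graph is hyperbolic, choose for each vertex [r] a geodesic from the
    treasure [v] to [r].  When the robber, standing at [r], moves by at most
    [psi] to [r'], the geodesics to [r] and [r'] stay at bounded distance [D] of
    one another up to the distance [psi + D] from [r], and [D] does not depend
    on [psi] ([fellow_travel]).  So a cop of speed [D + 1] can stand, after [k]
    stages, at distance [k] from [v] on the geodesic towards the robber.  As long
    as the robber is not caught it is farther than [k] from [v]: it is driven to
    infinity, and every ball around [v] ends up defended
    ([hyperbolic_cop_wins]).

    Conversely, suppose that one cop wins.  On a closed walk of length [n]
    the robber could run about at a speed that is a large multiple of the cop's.
    If all points that are far apart along the walk were also far apart in the
    graph, relative to [n], then the cop would threaten only a short arc at a time
    and the robber would always reach the opposite side before the cop has moved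
    noticeably.  So every sufficiently long closed walk has a shortcut: two of its
    points at distance at least [n / 8] along it, and at distance at most [n / M]
    in the graph, where [M] is as large as we please ([shortcuts_of_strong_win]).

    Shortcuts force triangles to be slim.  If triangles of bounded size are
    [D + 1]-slim but not all [D]-slim, for a large [D], then around a point [p] of
    a side that is farther than [D] from the two others there is a closed walk
    through [p] of length at most a constant times [D] which, within [D / 2] of
    [p], only runs along that side ([thick_closed_walk]).  Cut it along shortcuts,
    always keeping the part through [p], until it has length about [D / 26].  The
    lengths decrease geometrically, so the added shortcuts have total length at
    most a constant times [D / M].  What is left stays close to [p], hence consists
    of steps that move forward along a geodesic, apart from a negligible fraction:
    it cannot be closed ([no_climbing_closed_walk]).

    The second half works with vertices only.  A geodesic of the realization is
    replaced by the vertices near its points at integer times; this is the reason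
    for geodesics with an additive error ([rough]). *)

(** * Paths and the graph distance *)

Lemma last_cons (A : Type) (p : list A) (u w : A) : last (w :: p) u = last p w.
Proof.
  revert u w; induction p as [|b p IH]; intros u w; [reflexivity|].
  change (last (b :: p) u = last (b :: p) w). now rewrite !IH.
Qed.

Lemma last_app (A : Type) (p q : list A) (u : A) :
  last (p ++ q) u = last q (last p u).
Proof.
  revert u; induction p as [|b p IH]; intros u; [reflexivity|].
  cbn [app]. now rewrite !last_cons.
Qed.

Lemma is_path_app (V : Type) (e : V -> V -> Prop) (p q : list V) (u : V) :
  is_path e u (p ++ q) <-> is_path e u p /\ is_path e (last p u) q.
Proof.
  revert u; induction p as [|b p IH]; intros u; [simpl; tauto|].
  cbn [app is_path]. rewrite last_cons, IH. tauto.
Qed.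

Lemma last_in (A : Type) (p : list A) (u : A) : In (last p u) (u :: p).
Proof.
  revert u; induction p as [|b p IH]; intros u; [now left|].
  rewrite last_cons. right. apply IH.
Qed.

Lemma least_nat (P : nat -> Prop) :
  (exists n, P n) -> exists n, P n /\ forall m, P m -> n <= m.
Proof.
  intros H.
  destruct (dec_inh_nat_subset_has_unique_least_element P (fun n => classic (P n)) H)
    as (n & Hn & _). eauto.
Qed.

Section GraphDistance.
Variable G : graph.
Implicit Types u v w : G.

Lemma within_exists_least u v :
  exists k, within G k u v /\ forall m, within G m u v -> k <= m.
Proof.
  apply least_nat. destruct (connected G u v) as (p & Hp & Hl).
  exists (length p), p. auto.
Qed.

Definition gdist u v : nat :=
  proj1_sig (constructive_indefinite_description _ (within_exists_least u v)).

Lemma within_gdist k u v : within G k u v <-> gdist u v <= k.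
Proof.
  unfold gdist. destruct constructive_indefinite_description as [d [Hd Hm]]; simpl.
  split; [apply Hm|]. intros Hk. destruct Hd as (p & H1 & H2 & H3).
  exists p. repeat split; auto; lia.
Qed.

Lemma gdist_path u v : exists p, is_path adj u p /\ last p u = v /\ length p = gdist u v.
Proof.
  destruct (proj2 (within_gdist (gdist u v) u v)) as (p & H1 & H2 & H3); [lia|].
  exists p. repeat split; auto.
  assert (gdist u v <= length p) by (apply within_gdist; exists p; auto). lia.
Qed.

Lemma gdist_le_length u p : is_path adj u p -> gdist u (last p u) <= length p.
Proof. intros H. apply within_gdist. exists p; auto. Qed.

Lemma gdist_refl u : gdist u u = 0.
Proof. assert (H := gdist_le_length (u := u) (p := []) I). simpl in H; lia. Qed.

Lemma gdist_tri u v w : gdist u w <= gdist u v + gdist v w.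
Proof.
  destruct (gdist_path u v) as (p & Hp & Ep & Lp), (gdist_path v w) as (q & Hq & Eq & Lq).
  apply within_gdist. exists (p ++ q). rewrite is_path_app, last_app, length_app, Ep.
  repeat split; auto; lia.
Qed.

Lemma gdist_adj u v : adj u v -> gdist u v <= 1.
Proof. intros H. exact (gdist_le_length (u := u) (p := [v]) (conj H I)). Qed.

Lemma gdist_sym_le u v : gdist v u <= gdist u v.
Proof.
  destruct (gdist_path u v) as (p & Hp & Ep & <-). clear -Hp Ep.
  revert u Hp Ep; induction p as [|w p IH]; intros u.
  - simpl; intros _ ->. rewrite gdist_refl; lia.
  - rewrite last_cons. intros [Ha Hp] E. specialize (IH w Hp E).
    pose proof (gdist_tri v w u). apply adj_sym, gdist_adj in Ha. simpl; lia.
Qed.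

Lemma gdist_sym u v : gdist u v = gdist v u.
Proof. apply Nat.le_antisymm; apply gdist_sym_le. Qed.

Lemma adj_gdist u v : gdist u v = 1 -> adj u v.
Proof.
  destruct (gdist_path u v) as (p & Hp & E & L). intros E1. rewrite E1 in L.
  destruct p as [|w [|? ?]]; try discriminate. simpl in E; subst w. apply Hp.
Qed.

Definition geod_fun (n : nat) (a : nat -> G) : Prop :=
  forall i j, i <= j <= n -> gdist (a i) (a j) = j - i.

Lemma path_gdist_nth u p i j : is_path adj u p -> i <= j <= length p ->
  gdist (nth i (u :: p) u) (nth j (u :: p) u) <= j - i.
Proof.
  revert u i j. induction p as [|w p IH]; intros u i j.
  - simpl. intros _ H. assert (i = 0) by lia; assert (j = 0) by lia; subst.
    simpl. rewrite gdist_refl; lia.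
  - intros [Ha Hp] H.
    assert (N : forall k, k < length (w :: p) -> nth k (w :: p) u = nth k (w :: p) w).
    { intros k Hk. now apply nth_indep. }
    destruct j as [|j].
    + assert (i = 0) by lia; subst. simpl. rewrite gdist_refl; lia.
    + simpl in H. destruct i as [|i]; cbn [nth].
      * change (gdist u (nth j (w :: p) u) <= S j - 0).
        rewrite N by (simpl; lia).
        specialize (IH w 0 j Hp ltac:(lia)). cbn [nth] in IH.
        pose proof (gdist_tri u w (nth j (w :: p) w)).
        apply gdist_adj in Ha. unfold nth in *. lia.
      * change (gdist (nth i (w :: p) u) (nth j (w :: p) u) <= j - i).
        rewrite !N by (simpl; lia). apply IH; auto; lia.
Qed.

Lemma last_nth (A : Type) (p : list A) (u : A) : last p u = nth (length p) (u :: p) u.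
Proof.
  revert u; induction p as [|w p IH]; intros u; [reflexivity|].
  rewrite last_cons, IH. change (nth (length (w :: p)) (u :: w :: p) u) with
    (nth (length p) (w :: p) u). apply nth_indep; simpl; lia.
Qed.

Lemma geodesic_exists u v :
  exists a, a 0 = u /\ a (gdist u v) = v /\ geod_fun (gdist u v) a.
Proof.
  destruct (gdist_path u v) as (p & Hp & E & L).
  exists (fun i => nth i (u :: p) u). split; [reflexivity|]. split.
  - now rewrite <- L, <- last_nth.
  - intros i j H. pose proof (path_gdist_nth (u := u) (p := p) (i := i) (j := j) Hp ltac:(lia)).
    pose proof (path_gdist_nth (u := u) (p := p) (i := 0) (j := i) Hp ltac:(lia)) as Hi.
    pose proof (path_gdist_nth (u := u) (p := p) (i := j) (j := length p) Hp ltac:(lia)) as Hj.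
    rewrite <- last_nth, E in Hj.
    change (nth 0 (u :: p) u) with u in Hi.
    pose proof (gdist_tri u (nth i (u :: p) u) v).
    pose proof (gdist_tri (nth i (u :: p) u) (nth j (u :: p) u) v). lia.
Qed.

End GraphDistance.

(** * Vertices and geodesics in the geometric realization *)

Section Realization.
Variable G : graph.
Implicit Types u v w : G.
Local Open Scope R_scope.

Lemma vertex_point_coord u : vertex_point G u u = 1.
Proof. exact (proj1 (vertex_coordP G u)). Qed.

Lemma vertex_point_coord0 u w : w <> u -> vertex_point G u w = 0.
Proof. exact (proj2 (vertex_coordP G u) w). Qed.

Lemma on_edge_sym u v (x : point G) : on_edge G u v x -> on_edge G v u x.
Proof.
  intros (a & H1 & H2 & H3 & H4). repeat split; auto using adj_sym; lra.
Qed.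

Lemma on_edge_vertex u v (x : point G) : on_edge G u v x -> x u = 1 -> x = vertex_point G u.
Proof.
  intros (a & H1 & H2 & H3 & H4) E. apply point_eq. intros w.
  destruct (classic (w = u)) as [->|n]; [now rewrite vertex_point_coord|].
  rewrite vertex_point_coord0 by assumption.
  destruct (classic (w = v)) as [->|n']; [lra|auto].
Qed.

Lemma on_edge_dist u v (x y : point G) :
  on_edge G u v x -> on_edge G u v y -> length_dist x y <= Rabs (x u - y u).
Proof.
  intros Hx Hy. apply length_dist_le. rewrite <- (Rplus_0_r (Rabs _)).
  eapply chain_cons; eauto. constructor.
Qed.

Lemma adj_length_dist u v : adj u v -> length_dist (vertex_point G u) (vertex_point G v) <= 1.
Proof.
  intros a. destruct (vertex_on_edge G u v a) as [Hu Hv].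
  eapply Rle_trans; [apply (on_edge_dist Hu Hv)|].
  rewrite vertex_point_coord, vertex_point_coord0, Rminus_0_r, Rabs_R1; [lra|].
  intros ->; exact (adj_irrefl G v a).
Qed.

Lemma length_dist_le_gdist u v :
  length_dist (vertex_point G u) (vertex_point G v) <= INR (gdist u v).
Proof.
  destruct (gdist_path u v) as (p & Hp & <- & <-). revert u Hp.
  induction p as [|w p IH]; intros u Hp.
  - simpl. apply Req_le, length_dist_refl. reflexivity.
  - rewrite last_cons. destruct Hp as [a Hp]. specialize (IH w Hp).
    change (length (w :: p)) with (S (length p)). rewrite S_INR.
    pose proof (adj_length_dist a).
    pose proof (length_dist_tri (vertex_point G u) (vertex_point G (last p w)) (vertex_point G w)).
    lra.
Qed.

(** Any path from [x] to [v] leaves the edge of [x] through one of its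
    endpoints.  Bounding the length of a chain below by [d(w,v) + (1 - x w)] for
    some [w] in the support of [x] is what survives the induction on chains,
    because the support may change along the chain. *)
Lemma chain_to_vertex_length (x z : point G) l : chain x z l -> forall v, z = vertex_point G v ->
  exists w, 0 < x w /\ INR (gdist w v) + 1 - x w <= l.
Proof.
  induction 1 as [x|a b x y z l Hx Hy _ IH]; intros v ->.
  - exists v. rewrite gdist_refl, vertex_point_coord. simpl. lra.
  - destruct (IH v eq_refl) as (w & Hw & Hl). clear IH.
    assert (E : exists w', on_edge G w w' x /\ on_edge G w w' y /\
                           Rabs (x a - y a) = Rabs (x w - y w)).
    { destruct (classic (w = a)) as [->|na]; [now exists b|].
      destruct (classic (w = b)) as [->|nb].
      - exists a. split; [now apply on_edge_sym|split; [now apply on_edge_sym|]].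
        destruct Hx as (_ & _ & _ & sx & _), Hy as (_ & _ & _ & sy & _).
        rewrite <- (Rabs_Ropp (x b - _)). f_equal. lra.
      - destruct Hy as (_ & _ & _ & _ & zy). rewrite zy in Hw by assumption. lra. }
    destruct E as (w' & Hx' & Hy' & ->). clear Hx Hy.
    (* If [x] is the other endpoint of the edge, [w] must be replaced by it. *)
    destruct (Rle_lt_dec (x w) 0) as [H0|H0].
    + exists w'. destruct Hx' as (aw & px & _ & sx & _), Hy' as (_ & _ & qy & sy & _).
      assert (x w = 0) as E by lra. rewrite E. replace (x w') with 1 by lra.
      split; [lra|]. replace (0 - y w) with (- y w) by lra.
      rewrite Rabs_Ropp, Rabs_pos_eq by lra.
      assert (INR (gdist w' v) <= 1 + INR (gdist w v)).
      { replace 1 with (INR 1) by reflexivity. rewrite <- plus_INR. apply le_INR.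
        pose proof (gdist_tri w' w v). apply adj_sym, gdist_adj in aw. lia. }
      lra.
    + exists w. split; [assumption|].
      pose proof (Rle_abs (y w - x w)). rewrite Rabs_minus_sym in H. lra.
Qed.

Lemma length_dist_vertices u v :
  length_dist (vertex_point G u) (vertex_point G v) = INR (gdist u v).
Proof.
  apply Rle_antisym; [apply length_dist_le_gdist|].
  apply le_length_dist. intros l Hl.
  destruct (chain_to_vertex_length Hl eq_refl) as (w & Hw & H).
  destruct (classic (w = u)) as [->|n].
  - rewrite vertex_point_coord in H. lra.
  - rewrite vertex_point_coord0 in Hw by assumption. lra.
Qed.

Lemma vertex_near_point (x : point G) : exists u, length_dist x (vertex_point G u) <= 1.
Proof.
  destruct (coord_spec x) as [[u [u1 u0]]|[u [v H]]].
  - exists u. replace x with (vertex_point G u).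
    + rewrite (proj2 (length_dist_refl _ _) eq_refl). lra.
    + apply point_eq. intros w. destruct (classic (w = u)) as [->|n].
      * now rewrite vertex_point_coord, u1.
      * now rewrite vertex_point_coord0, u0.
  - exists u. destruct (vertex_on_edge G u v (proj1 H)) as [Hu _].
    eapply Rle_trans; [apply (on_edge_dist H Hu)|]. rewrite vertex_point_coord.
    destruct H as (_ & H1 & H2 & H3 & _). apply Rabs_le. lra.
Qed.

Lemma edge_point_exists u v (t : R) : adj u v -> 0 <= t <= 1 ->
  exists x : point G, on_edge G u v x /\ x v = t.
Proof.
  intros a Ht. assert (n : u <> v) by (intros ->; exact (adj_irrefl G v a)).
  set (f := fun w => if excluded_middle_informative (w = u) then 1 - t else
                     if excluded_middle_informative (w = v) then t else 0).
  assert (fu : f u = 1 - t) by (unfold f; destruct excluded_middle_informative; tauto).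
  assert (fv : f v = t).
  { unfold f. repeat destruct excluded_middle_informative; congruence. }
  assert (H : on_edge G u v f).
  { split; [exact a|]. rewrite fu, fv. repeat split; try lra.
    intros w n1 n2. unfold f. repeat destruct excluded_middle_informative; tauto. }
  exists {| coord := f; coord_spec := or_intror (ex_intro _ u (ex_intro _ v H)) |}.
  auto.
Qed.

(** A relation rather than a function of [s]: when [s] is an integer both edges
    at the vertex are allowed, so that no rounding has to be chosen. *)
Definition along (n : nat) (a : nat -> G) (s : R) (x : point G) : Prop :=
  exists i, (i < n)%nat /\ INR i <= s <= INR i + 1 /\
    on_edge G (a i) (a (S i)) x /\ x (a (S i)) = s - INR i.

Section Interpolation.
Variables (n : nat) (a : nat -> G).
Hypothesis geod_a : geod_fun n a.

Lemma geod_fun_adj i : (i < n)%nat -> adj (a i) (a (S i)).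
Proof. intros H. apply adj_gdist. rewrite geod_a; lia. Qed.

Lemma along_exists s : 0 <= s <= INR n -> (0 < n)%nat -> exists x, along n a s x.
Proof.
  intros Hs Hn.
  assert (E : exists i, (i < n)%nat /\ INR i <= s <= INR i + 1).
  { clear -Hs Hn. destruct n as [|m]; [lia|]. clear n Hn.
    revert Hs; induction m as [|m IH]; intros Hs.
    - exists 0%nat. simpl in *. split; [lia|lra].
    - destruct (Rle_lt_dec s (INR (S m))) as [H|H].
      + destruct IH as (i & Hi & H'); [lra|]. exists i; split; [lia|exact H'].
      + exists (S m). rewrite S_INR in Hs. split; [lia|lra]. }
  destruct E as (i & Hi & H).
  destruct (edge_point_exists (t := s - INR i) (geod_fun_adj Hi)) as (x & Hx & Ex); [lra|].
  exists x, i. auto.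
Qed.

Lemma along_vertex i : (i <= n)%nat -> (0 < n)%nat -> forall x, along n a (INR i) x ->
  x = vertex_point G (a i).
Proof.
  intros Hi Hn x (j & Hj & H & Hx & E).
  assert (i = j \/ i = S j) as [->| ->].
  { destruct H as [H1 H2]. apply INR_le in H1. rewrite <- S_INR in H2. apply INR_le in H2. lia. }
  - apply (on_edge_vertex Hx). destruct Hx as (_ & _ & _ & H3 & _). lra.
  - apply (on_edge_vertex (on_edge_sym Hx)). rewrite E, S_INR. ring.
Qed.

Lemma along_to_vertices s (x : point G) i : (i < n)%nat ->
  on_edge G (a i) (a (S i)) x -> x (a (S i)) = s - INR i -> INR i <= s <= INR i + 1 ->
  length_dist x (vertex_point G (a i)) <= s - INR i /\
  length_dist x (vertex_point G (a (S i))) <= INR i + 1 - s.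
Proof.
  intros Hi Hx E Hs. pose proof (geod_fun_adj Hi) as A.
  assert (N : a i <> a (S i)) by (intros e; rewrite e in A; exact (adj_irrefl G _ A)).
  destruct (vertex_on_edge G _ _ A) as [H1 H2].
  split; (eapply Rle_trans; [eapply on_edge_dist; apply on_edge_sym; eassumption|]).
  - rewrite E, vertex_point_coord0 by congruence. rewrite Rminus_0_r, Rabs_pos_eq; lra.
  - rewrite E, vertex_point_coord. apply Rabs_le. lra.
Qed.

Lemma along_lipschitz s t x y : along n a s x -> along n a t y -> s <= t ->
  length_dist x y <= t - s.
Proof.
  intros Hx Hy Hst.
  destruct Hx as (i & Hi & Bi & Ex & Cx), Hy as (j & Hj & Bj & Ey & Cy).
  destruct (along_to_vertices Hi Ex Cx Bi) as [X1 X2].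
  destruct (along_to_vertices Hj Ey Cy Bj) as [Y1 Y2].
  rewrite length_dist_sym in Y1, Y2.
  destruct (Nat.lt_total i j) as [L|[->|L]].
  - pose proof (length_dist_tri x y (vertex_point G (a (S i)))).
    pose proof (length_dist_tri (vertex_point G (a (S i))) y (vertex_point G (a j))).
    rewrite length_dist_vertices, geod_a, minus_INR, S_INR in * by lia. lra.
  - eapply Rle_trans; [eapply on_edge_dist; apply on_edge_sym; eassumption|].
    rewrite Cx, Cy, Rabs_minus_sym, Rabs_pos_eq; lra.
  - assert (INR j + 1 <= INR i) by (rewrite <- S_INR; apply le_INR; lia).
    assert (INR j + 1 = INR i) as E by lra.
    rewrite <- S_INR in E. apply INR_eq in E. subst i.
    pose proof (length_dist_tri x y (vertex_point G (a (S j)))). lra.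
Qed.

End Interpolation.

(** Slimness speaks of continuous geodesics, so geodesic edge paths have to be
    turned into such.  Being 1-Lipschitz and joining points at distance [n] in
    time [n] makes the interpolated path isometric. *)
Lemma geodesic_realization n (a : nat -> G) : geod_fun n a ->
  exists g : R -> point G,
    geodesic (realization G) (vertex_point G (a 0%nat)) (vertex_point G (a n)) g /\
    forall i, (i <= n)%nat -> g (INR i) = vertex_point G (a i).
Proof.
  intros Ha. destruct (Nat.eq_dec n 0) as [->|Hn].
  - exists (fun _ => vertex_point G (a 0%nat)).
    assert (Z : forall x : point G, length_dist x x = 0) by (intros x; now apply length_dist_refl).
    split.
    + repeat split. simpl. rewrite !Z. intros s t Hs Ht.
      replace (s - t) with 0 by lra. now rewrite Rabs_R0.
    + intros i Hi. now replace i with 0%nat by lia.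
  - assert (E : forall s, exists x, 0 <= s <= INR n -> along n a s x).
    { intros s. destruct (classic (0 <= s <= INR n)) as [H|H].
      - destruct (along_exists Ha H) as [x Hx]; [lia|]. eauto.
      - exists (vertex_point G (a 0%nat)). tauto. }
    set (g := fun s => proj1_sig (constructive_indefinite_description _ (E s))).
    assert (Hg : forall s, 0 <= s <= INR n -> along n a s (g s)).
    { intros s. exact (proj2_sig (constructive_indefinite_description _ (E s))). }
    assert (V : forall i, (i <= n)%nat -> g (INR i) = vertex_point G (a i)).
    { intros i Hi. apply (along_vertex (n := n)); [assumption|lia|]. apply Hg.
      split; [apply pos_INR|now apply le_INR]. }
    assert (D : length_dist (vertex_point G (a 0%nat)) (vertex_point G (a n)) = INR n).
    { rewrite length_dist_vertices, Ha by lia. f_equal. lia. }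
    exists g. split; [|exact V]. unfold geodesic. simpl. rewrite D.
    split; [exact (V 0%nat ltac:(lia))|]. split; [exact (V n ltac:(lia))|].
    assert (M : forall s t, 0 <= s -> s <= t -> t <= INR n -> length_dist (g s) (g t) = t - s).
    { intros s t H1 H2 H3.
      assert (L : forall s t, 0 <= s -> s <= t -> t <= INR n -> length_dist (g s) (g t) <= t - s).
      { intros s' t' ? ? ?. apply (along_lipschitz Ha); try apply Hg; lra. }
      apply Rle_antisym; [apply L; assumption|].
      pose proof (L 0 s ltac:(lra) ltac:(lra) ltac:(lra)) as L1.
      pose proof (L t (INR n) ltac:(lra) ltac:(lra) ltac:(lra)) as L2.
      replace 0 with (INR 0) in L1 at 1 by reflexivity.
      rewrite V in L1 by lia. rewrite V in L2 by lia.
      pose proof (length_dist_tri (vertex_point G (a 0%nat)) (vertex_point G (a n)) (g s)).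
      pose proof (length_dist_tri (g s) (vertex_point G (a n)) (g t)). lra. }
    intros s t Hs Ht. destruct (Rle_lt_dec s t).
    + rewrite M by lra. rewrite Rabs_minus_sym, Rabs_pos_eq; lra.
    + rewrite length_dist_sym, M by lra. rewrite Rabs_pos_eq; lra.
Qed.

End Realization.

(** * One cop wins on a hyperbolic graph *)

Section CopWins.
Variable G : graph.
Implicit Types u v w : G.

(** Apply slimness to the triangle [v], [r'], [r].  The point [a t] is too far
    from [r] to be near the side from [r'] to [r], so it is within [delta] of some
    [a' s]; comparing distances to [v] gives [|s - t| <= delta]. *)
Lemma fellow_travel : hyperbolic_graph G -> exists D, forall psi v r r' m m' (a a' : nat -> G),
  geod_fun m a -> geod_fun m' a' -> a 0 = v -> a' 0 = v -> a m = r -> a' m' = r' ->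
  gdist r r' <= psi -> forall t, t + psi + D < m -> gdist (a t) (a' t) <= D.
Proof.
  intros [delta Hd].
  destruct (INR_unbounded (2 * Rabs delta)%R) as [D HD].
  exists D. intros psi v r r' m m' a a' Ha Ha' E0 E0' E1 E1' Hr t Ht.
  assert (Lm : gdist v r = m) by (rewrite <- E0, <- E1, Ha; lia).
  assert (Lm' : gdist v r' = m') by (rewrite <- E0', <- E1', Ha'; lia).
  destruct (geodesic_realization Ha) as (g & Hg & Vg).
  destruct (geodesic_realization Ha') as (g' & Hg' & Vg').
  destruct (geodesic_exists r' r) as (e & e0 & e1 & He).
  destruct (geodesic_realization He) as (h & Hh & _).
  rewrite E0, E1 in Hg. rewrite E0', E1' in Hg'. rewrite e0, e1 in Hh.
  specialize (Hd _ _ _ _ _ _ Hg' Hh Hg (INR t)). rewrite Vg in Hd by lia.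
  destruct Hg as (_ & _ & Ig), Hg' as (g'0 & _ & Ig'), Hh as (_ & h1 & Ih).
  unfold near_geodesic in Hd. simpl in *. rewrite !length_dist_vertices, Lm, Lm' in *.
  pose proof (gdist_sym r' r) as Sr.
  pose proof (Rle_abs delta) as Pd.
  assert (T0 := pos_INR t). assert (M0 := pos_INR m').
  assert (INR t <= INR m)%R by (apply le_INR; lia).
  assert (Tr : (INR t + INR psi + INR D < INR m)%R) by (rewrite <- !plus_INR; apply lt_INR; lia).
  assert (dv : gdist (a 0) (a t) = t) by (rewrite Ha; lia).
  assert (dr : gdist (a t) r = m - t) by (rewrite <- E1, Ha; lia).
  assert (Hm' : t <= m') by (pose proof (gdist_tri v r' r); lia).
  destruct Hd as [(s & Hs & Ds)|(s & Hs & Ds)]; [lra| |].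
  - assert (Hst : (Rabs (s - INR t) <= Rabs delta)%R).
    { pose proof (length_dist_tri (vertex_point G v) (vertex_point G (a t)) (g' s)) as T1.
      pose proof (length_dist_tri (vertex_point G v) (g' s) (vertex_point G (a t))) as T2.
      rewrite (length_dist_sym (g' s) (vertex_point G (a t))) in T1.
      rewrite length_dist_vertices, <- E0, dv, E0 in T1, T2.
      rewrite <- g'0, Ig' in T1, T2 by lra.
      replace (0 - s)%R with (- s)%R in T1, T2 by ring.
      rewrite Rabs_Ropp, (Rabs_pos_eq s) in T1, T2 by lra.
      apply Rabs_le. lra. }
    apply INR_le. rewrite <- length_dist_vertices, <- (Vg' t Hm').
    pose proof (length_dist_tri (vertex_point G (a t)) (g' (INR t)) (g' s)) as T.
    rewrite Ig' in T; [lra|lra|]. split; [lra|apply le_INR, Hm'].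
  - exfalso.
    pose proof (length_dist_tri (vertex_point G (a t)) (vertex_point G r) (h s)) as T.
    rewrite length_dist_vertices, dr, minus_INR in T by lia.
    rewrite <- h1, Ih in T by lra.
    assert (INR (gdist r' r) <= INR psi)%R by (apply le_INR; lia).
    rewrite Rabs_minus_sym, Rabs_pos_eq in T by lra.
    pose proof (Rabs_pos delta). lra.
Qed.

(** The same geodesic is used each time the robber is at [r], so the position
    that the cop aims at depends on [r] and the number of the stage only. *)
Definition ray (v r : G) : nat -> G :=
  proj1_sig (constructive_indefinite_description _ (geodesic_exists v r)).

Lemma rayP v r : ray v r 0 = v /\ ray v r (gdist v r) = r /\ geod_fun (gdist v r) (ray v r).
Proof. exact (proj2_sig (constructive_indefinite_description _ (geodesic_exists v r))). Qed.

Section Pursuit.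
Variables (v : G) (sigma : nat).

(** The cop aims at the vertex at distance [k] from [v] on the geodesic to the
    robber.  It stays where it is if this vertex is out of reach, since a strategy
    has to be legal against every play, even after a capture. *)
Fixpoint pursue (k : nat) (r c : G) (l : list (list G)) : G :=
  match l with
  | [] => c
  | p :: l' =>
      let r' := last p r in
      pursue (S k) r' (if le_dec (gdist c (ray v r' (S k))) sigma
                       then ray v r' (S k) else c) l'
  end.

Definition pursuit : cop_strategy G 1 :=
  {| cop_start := fun _ => v; cop_next := fun r l _ => pursue 0 r v l |}.

Definition robber_after (r : G) (l : list (list G)) : G := fold_left (fun x p => last p x) l r.

Lemma pursue_snoc l p k r c :
  pursue k r c (l ++ [p]) =
  let c' := pursue k r c l in
  let t := ray v (last p (robber_after r l)) (S (k + length l)) in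
  if le_dec (gdist c' t) sigma then t else c'.
Proof.
  revert k r c; induction l as [|q l IH]; intros k r c.
  - simpl. now rewrite Nat.add_0_r.
  - cbn [app pursue length robber_after fold_left]. rewrite IH.
    now rewrite <- Nat.add_succ_comm.
Qed.

Lemma robber_pos_after (r : robber_play G) k :
  robber_pos r k = robber_after (robber_start r) (map (robber_move r) (seq 0 k)).
Proof.
  induction k as [|k IH]; [reflexivity|].
  rewrite seq_S, map_app. unfold robber_after. rewrite fold_left_app.
  cbn. now rewrite IH.
Qed.

Lemma pursuit_step (r : robber_play G) k i :
  cop_pos pursuit r (S (S k)) i =
  let c := cop_pos pursuit r (S k) i in
  let t := ray v (robber_pos r (S k)) (S k) in
  if le_dec (gdist c t) sigma then t else c.
Proof.
  cbn [cop_pos pursuit cop_next]. rewrite seq_S, map_app. cbn [map].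
  rewrite pursue_snoc, length_map, length_seq, <- robber_pos_after. reflexivity.
Qed.

Lemma pursuit_legal psi : legal_cops sigma psi pursuit.
Proof.
  intros r _ k i. apply within_gdist. rewrite Nat.add_1_r. destruct k as [|k].
  - simpl. rewrite gdist_refl. lia.
  - rewrite pursuit_step. simpl. destruct le_dec; [assumption|]. rewrite gdist_refl. lia.
Qed.

End Pursuit.

Lemma gdist_robber psi (r : robber_play G) k w : legal_robber psi r -> robber_at r k w ->
  gdist (robber_pos r k) w <= psi.
Proof.
  intros H Hw. destruct (H k) as [Hp Hl].
  destruct (In_nth _ _ (robber_pos r k) Hw) as (i & Hi & <-).
  pose proof (path_gdist_nth (i := 0) (j := i) Hp). simpl in *. 
  cbn [nth] in H0. lia.
Qed.

(** By induction, while the robber is free, the cop is at its target and the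
    robber is more than [k + psi + D] away from [v] at stage [k].  That is the room
    which [fellow_travel] needs for the next move. *)
Theorem hyperbolic_cop_wins : hyperbolic_graph G -> strong_cops_win G 1.
Proof.
  intros HG v. destruct (fellow_travel HG) as [D HD].
  exists (S D). split; [lia|]. intros psi _. exists (S (psi + D)). split; [lia|].
  intros rad _. exists (pursuit v (S D)). split; [apply pursuit_legal|].
  intros r Hr. destruct (classic (captured (S (psi + D)) (pursuit v (S D)) r)) as [C|C]; [now left|].
  right.
  assert (F : forall k i, S (psi + D) < gdist (cop_pos (pursuit v (S D)) r (S k) i) (robber_pos r k)).
  { intros k i. destruct (le_lt_dec (gdist (cop_pos (pursuit v (S D)) r (S k) i) (robber_pos r k))
      (S (psi + D))) as [L|L]; [|exact L]. destruct C. exists k, (robber_pos r k), i.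
    split; [now left|]. rewrite Nat.add_1_r. now apply within_gdist. }
  assert (I : forall k, cop_pos (pursuit v (S D)) r (S k) Fin.F1 = ray v (robber_pos r k) k /\
                        k + psi + D < gdist v (robber_pos r k)).
  { assert (A : forall k, k <= gdist v (robber_pos r k) ->
      cop_pos (pursuit v (S D)) r (S k) Fin.F1 = ray v (robber_pos r k) k ->
      k + S (psi + D) < gdist v (robber_pos r k)).
    { intros k Hk E. specialize (F k Fin.F1). rewrite E in F.
      destruct (rayP v (robber_pos r k)) as (_ & E1 & Hg).
      rewrite <- E1 in F at 2. rewrite Hg in F by lia. lia. }
    induction k as [|k [IH1 IH2]].
    - assert (E : cop_pos (pursuit v (S D)) r 1 Fin.F1 = ray v (robber_pos r 0) 0).
      { destruct (rayP v (robber_pos r 0)) as (E0 & _). now rewrite E0. }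
      split; [exact E|]. apply A in E; lia.
    - destruct (rayP v (robber_pos r k)) as (E0 & E1 & Hg).
      destruct (rayP v (robber_pos r (S k))) as (E0' & E1' & Hg').
      assert (M : gdist (robber_pos r k) (robber_pos r (S k)) <= psi).
      { apply (gdist_robber Hr). apply last_in. }
      assert (K : S k <= gdist v (robber_pos r (S k))).
      { pose proof (gdist_tri v (robber_pos r (S k)) (robber_pos r k)) as T.
        rewrite (gdist_sym (robber_pos r (S k))) in T. lia. }
      assert (E : cop_pos (pursuit v (S D)) r (S (S k)) Fin.F1 = ray v (robber_pos r (S k)) (S k)).
      { rewrite pursuit_step. cbv zeta. rewrite IH1. destruct le_dec as [_|n]; [reflexivity|].
        exfalso. apply n.
        pose proof (HD psi v _ _ _ _ _ _ Hg Hg' E0 E0' E1 E1' M k ltac:(lia)).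
        pose proof (Hg' k (S k) ltac:(lia)).
        pose proof (gdist_tri (ray v (robber_pos r k) k) (ray v (robber_pos r (S k)) k)
                      (ray v (robber_pos r (S k)) (S k))). lia. }
      split; [exact E|]. apply A in E; lia. }
  exists rad. intros k w Hk Hw. rewrite within_gdist. destruct (I k) as [_ Ik].
  pose proof (gdist_robber Hr Hw). pose proof (gdist_tri v w (robber_pos r k)) as T.
  rewrite (gdist_sym w) in T. lia.
Qed.

End CopWins.

(** A set of positive integers without 1 is bounded below by 2. *)
Lemma sCop_eq1 (G : graph) : sCop G = Finite 1%R <-> strong_cops_win G 1.
Proof.
  unfold sCop. set (E := fun x => _). pose proof (Glb_Rbar_correct E) as H. split.
  - intros e. rewrite e in H. apply NNPP. intros N.
    assert (L : Rbar_le (Finite 2) (Finite 1)).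
    { apply (proj2 H). intros x (n & Hn & Sn & ->). simpl.
      destruct (Nat.eq_dec n 1) as [->|n1]; [contradiction|].
      apply (le_INR 2). lia. }
    simpl in L. lra.
  - intros W. apply is_glb_Rbar_unique. split.
    + intros x (n & Hn & _ & ->). simpl. apply (le_INR 1). lia.
    + intros b Hb. apply Hb. exists 1. repeat split; auto.
Qed.

(** * The robber on a closed walk without shortcuts *)

Section Robber.
Variable G : graph.
Implicit Types u v w q : G.

(** A relation between the robber's position [u] and the position [q] of the
    cop that has just moved, which the robber can maintain forever without being
    caught and without leaving the ball of radius [rad]. *)
Definition safe_region (v : G) (sigma psi rho rad : nat) (W : G -> G -> Prop) : Prop :=
  forall u q, W u q -> exists p, is_path adj u p /\ length p <= psi /\
    (forall w, In w (u :: p) -> rho < gdist q w /\ gdist v w <= rad) /\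
    forall q', gdist q q' <= sigma -> W (last p u) q'.

(** The robber's answers are chosen to be legal even outside [W].  Thus the
    play is legal by itself, which is needed before legality of the cop's moves can
    be used to show that the play remains in [W]. *)
Lemma safe_region_escapes v sigma psi rho rad (W : G -> G -> Prop) :
  (forall q, exists u, forall q', gdist q q' <= sigma -> W u q') ->
  safe_region v sigma psi rho rad W -> ~ cops_win G 1 v sigma psi rho rad.
Proof.
  intros W0 W1 (St & LS & Win).
  assert (F : forall uq : G * G, exists p, is_path adj (fst uq) p /\ length p <= psi /\
    (W (fst uq) (snd uq) ->
     (forall w, In w (fst uq :: p) -> rho < gdist (snd uq) w /\ gdist v w <= rad) /\
     forall q', gdist (snd uq) q' <= sigma -> W (last p (fst uq)) q')).
  { intros [u q]; simpl. destruct (classic (W u q)) as [H|H].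
    - destruct (W1 u q H) as (p & H1 & H2 & H3). exists p. auto.
    - exists []. simpl. repeat split; try lia; tauto. }
  set (f := fun u q => proj1_sig (constructive_indefinite_description _ (F (u, q)))).
  assert (Hf : forall u q, is_path adj u (f u q) /\ length (f u q) <= psi /\
    (W u q -> (forall w, In w (u :: f u q) -> rho < gdist q w /\ gdist v w <= rad) /\
     forall q', gdist q q' <= sigma -> W (last (f u q) u) q')).
  { intros u q. exact (proj2_sig (constructive_indefinite_description _ (F (u, q)))). }
  clearbody f. clear F.
  destruct (W0 (cop_start St Fin.F1)) as [u0 Hu0].
  set (reply := fun l => f (robber_after u0 l) (cop_next St u0 l Fin.F1)).
  set (hist := fix hist k := match k with 0 => [] | S k => hist k ++ [reply (hist k)] end).
  set (r := {| robber_start := u0; robber_move := fun k => reply (hist k) |}).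
  assert (Hh : forall k, map (robber_move r) (seq 0 k) = hist k).
  { induction k as [|k IH]; [reflexivity|]. rewrite seq_S, map_app, IH. reflexivity. }
  assert (Hm : forall k, robber_move r k = f (robber_pos r k) (cop_pos St r (S k) Fin.F1)).
  { intros k. rewrite robber_pos_after. cbn [cop_pos]. rewrite Hh. reflexivity. }
  assert (Lr : legal_robber psi r) by (intros k; rewrite Hm; split; apply Hf).
  assert (HW : forall k, W (robber_pos r k) (cop_pos St r (S k) Fin.F1)).
  { induction k as [|k IH].
    - apply Hu0. apply within_gdist. exact (LS r Lr 0 Fin.F1).
    - change (robber_pos r (S k)) with (last (robber_move r k) (robber_pos r k)).
      rewrite Hm. apply (Hf _ _). { exact IH. }
      apply within_gdist. rewrite <- (Nat.add_1_r (S k)). apply LS, Lr. }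
  assert (HR : forall k w, robber_at r k w ->
    rho < gdist (cop_pos St r (S k) Fin.F1) w /\ gdist v w <= rad).
  { intros k w Hw. unfold robber_at in Hw. rewrite Hm in Hw.
    destruct (Hf (robber_pos r k) (cop_pos St r (S k) Fin.F1)) as (_ & _ & H).
    exact (proj1 (H (HW k)) w Hw). }
  destruct (Win r Lr) as [(k & w & i & Hw & Hc)|(N & HN)].
  - rewrite Nat.add_1_r, within_gdist in Hc.
    assert (i = Fin.F1) as ->.
    { apply (Fin.caseS' i); [reflexivity|]. intros j. apply (Fin.case0 (fun j => Fin.FS j = Fin.F1) j). }
    apply HR in Hw. lia.
  - apply (HN N (robber_pos r N)); [lia|now left|]. apply within_gdist.
    apply (HR N). now left.
Qed.

Definition between (x y z : Z) : Prop := (x <= z <= y \/ y <= z <= x)%Z.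

Section ClosedWalk.
Variables (c : Z -> G) (n b : nat).
Hypothesis c_periodic : forall z, c (z + Z.of_nat n) = c z.
Hypothesis c_step : forall z, gdist (c z) (c (z + 1)%Z) <= b.

Lemma periodic_mult k z : c (z + k * Z.of_nat n) = c z.
Proof.
  assert (P : forall (m : nat) z, c (z + Z.of_nat m * Z.of_nat n) = c z).
  { induction m as [|m IH]; intros y.
    - f_equal. lia.
    - rewrite <- (IH y), <- (c_periodic (y + Z.of_nat m * _)). f_equal.
      rewrite Nat2Z.inj_succ. ring. }
  destruct (Z.le_ge_cases 0 k) as [H|H].
  - rewrite <- (Z2Nat.id k H). apply P.
  - rewrite <- (P (Z.to_nat (- k)) (z + _)%Z). f_equal. rewrite Z2Nat.id by lia. ring.
Qed.

Lemma closed_walk_path s x y : (Z.abs (y - x) <= Z.of_nat s)%Z ->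
  exists p, is_path adj (c x) p /\ last p (c x) = c y /\ length p <= b * s /\
    forall w, In w (c x :: p) -> exists z, between x y z /\ gdist (c z) w <= b.
Proof.
  revert x; induction s as [|s IH]; intros x H.
  - assert (y = x) as -> by lia. exists []. repeat split; simpl; try lia.
    intros w [<-|[]]. exists x. split; [unfold between; lia|]. rewrite gdist_refl. lia.
  - destruct (Z.eq_dec y x) as [->|N].
    { exists []. repeat split; simpl; try lia.
      intros w [<-|[]]. exists x. split; [unfold between; lia|]. rewrite gdist_refl. lia. }
    set (x' := (if Z_lt_dec x y then x + 1 else x - 1)%Z).
    assert (Bx : (x' = x + 1 /\ x < y \/ x' = x - 1 /\ y < x)%Z)
      by (unfold x'; destruct Z_lt_dec; lia).
    assert (Sx : gdist (c x) (c x') <= b).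
    { destruct Bx as [[-> _]|[E _]]; [apply c_step|].
      rewrite gdist_sym. replace x with (x' + 1)%Z by lia. apply c_step. }
    clearbody x'. destruct (IH x') as (p & P1 & P2 & P3 & P4); [lia|].
    destruct (gdist_path (c x) (c x')) as (e & E1 & E2 & E3).
    exists (e ++ p). rewrite is_path_app, last_app, length_app, E2.
    repeat split; auto; [lia|]. intros w Hw.
    change (In w ((c x :: e) ++ p)) in Hw. apply in_app_or in Hw. destruct Hw as [Hw|Hw].
    + exists x. split; [unfold between; lia|].
      destruct (In_nth _ _ (c x) Hw) as (i & Hi & <-).
      pose proof (path_gdist_nth (i := 0) (j := i) E1) as H0. simpl in Hi.
      cbn [nth] in *. lia.
    + destruct (P4 w) as (z & Z1 & Z2); [now right|]. exists z. split; [|exact Z2].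
      unfold between in *. lia.
Qed.

Lemma closed_walk_bounded v : 0 < n -> exists rad, forall z, gdist v (c z) <= rad.
Proof.
  intros Hn. exists (gdist v (c 0) + b * n). intros z.
  destruct (@closed_walk_path n 0 (z mod Z.of_nat n)) as (p & P1 & P2 & P3 & _).
  { pose proof (Z.mod_pos_bound z (Z.of_nat n)). lia. }
  pose proof (gdist_le_length P1) as L. rewrite P2 in L.
  replace (c z) with (c (z mod Z.of_nat n)).
  - pose proof (gdist_tri v (c 0) (c (z mod Z.of_nat n))). lia.
  - rewrite <- (periodic_mult (z / Z.of_nat n) (z mod Z.of_nat n)). f_equal.
    rewrite (Z.div_mod z (Z.of_nat n)) at 3 by lia. ring.
Qed.

(** The robber plays in epochs of [T] stages, and covers up to [s] steps of the
    closed walk per stage, enough for a full turn in an epoch.  During an epoch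
    that starts with the cop at [q0], the cop stays within [sigma * T] of [q0], so
    it threatens only walk points within [L1] of [q0]; at the start of the next
    epoch, only those within [L2].  By [spread] the latter all lie in a short arc. *)
Section Evasion.
Variables (sigma s T rho : nat).
Let L1 := sigma * T + rho + b.
Let L2 := sigma * T + L1.
Hypothesis n_large : 4 <= n.
Hypothesis epoch_long : n <= s * T.
Hypothesis spread : forall i j, gdist (c i) (c j) <= 2 * L2 ->
  exists k, (8 * Z.abs (i - j - k * Z.of_nat n) < Z.of_nat n)%Z.

(** The robber stands at least a quarter of the walk away from the threatened
    points.  Positions are integers, compared modulo [n] through the quantifier on
    [k]. *)
Definition remote (t : nat) (x : Z) (q : G) : Prop :=
  forall j, gdist (c j) q <= t ->
  forall k, (Z.of_nat n <= 4 * Z.abs (x - j - k * Z.of_nat n))%Z.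

(** The state in the middle of an epoch: the robber runs straight to [tgt],
    [rem] stages are left, and the cop stood at [q0] when the epoch began.
    Recording these existentially makes the robber's strategy depend on the current
    positions only. *)
Definition evading (x : Z) (q : G) : Prop := exists tgt rem q0,
  rem <= T /\ (Z.abs (tgt - x) <= Z.of_nat (s * rem))%Z /\
  gdist q0 q <= sigma * (T - rem) /\
  (forall z, between x tgt z -> L1 < gdist (c z) q0) /\ remote L2 tgt q0.

Lemma spread_near q i j : gdist (c i) q <= L2 -> gdist (c j) q <= L2 ->
  exists k, (8 * Z.abs (i - j - k * Z.of_nat n) < Z.of_nat n)%Z.
Proof.
  intros Hi Hj. apply spread. pose proof (gdist_tri (c i) q (c j)) as H.
  rewrite (gdist_sym q) in H. lia.
Qed.

Lemma antipode_remote q j : gdist (c j) q <= L2 -> remote L2 (j + Z.of_nat n / 2) q.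
Proof.
  intros Hj i Hi k. destruct (spread_near Hi Hj) as [k0 Hk].
  set (m := Z.of_nat n) in *. assert (4 <= m)%Z by lia.
  assert (D : (m = 2 * (m / 2) \/ m = 2 * (m / 2) + 1)%Z).
  { pose proof (Z.div_mod m 2). pose proof (Z.mod_pos_bound m 2). lia. }
  set (h := (m / 2)%Z) in *.
  replace (j + h - i - k * m)%Z with (h - (i - j - k0 * m) - (k + k0) * m)%Z by ring.
  set (d := (i - j - k0 * m)%Z) in *. set (l := (k + k0)%Z).
  destruct (Z.le_gt_cases l 0) as [L|L].
  - assert (l * m <= 0)%Z by nia. lia.
  - assert (m <= l * m)%Z by nia. lia.
Qed.

Lemma remote_exists q : exists x, remote L2 x q.
Proof.
  destruct (classic (exists j, gdist (c j) q <= L2)) as [[j Hj]|N].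
  - exists (j + Z.of_nat n / 2)%Z. now apply antipode_remote.
  - exists 0%Z. intros j Hj. destruct N. eauto.
Qed.

(** The robber starts outside the short arc of threatened points, so it reaches
    the antipode of this arc by turning in the direction that avoids the arc. *)
Lemma remote_run x q : remote L1 x q ->
  exists tgt, (Z.abs (tgt - x) <= Z.of_nat n)%Z /\ remote L2 tgt q /\
    forall z, between x tgt z -> L1 < gdist (c z) q.
Proof.
  intros Hx. destruct (classic (exists j, gdist (c j) q <= L2)) as [[j0 Hj0]|N].
  - set (m := Z.of_nat n) in *. assert (4 <= m)%Z by lia.
    (* The representative of [j0] just below [x]: between it and the next one the
       run from [x] to the midpoint needs no reduction modulo [n]. *)
    set (j := (j0 + (x - j0) / m * m)%Z).
    assert (Ej : c j = c j0) by apply periodic_mult.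
    assert (Bj : (0 <= x - j < m)%Z).
    { pose proof (Z.div_mod (x - j0) m ltac:(lia)).
      pose proof (Z.mod_pos_bound (x - j0) m ltac:(lia)).
      unfold j. rewrite (Z.mul_comm _ m). lia. }
    rewrite <- Ej in Hj0. clearbody j. exists (j + m / 2)%Z.
    assert (D : (m = 2 * (m / 2) \/ m = 2 * (m / 2) + 1)%Z).
    { pose proof (Z.div_mod m 2). pose proof (Z.mod_pos_bound m 2). lia. }
    split; [lia|]. split; [now apply antipode_remote|]. intros z Hz.
    destruct (Nat.lt_ge_cases L1 (gdist (c z) q)) as [Lz|Lz]; [exact Lz|exfalso].
    destruct (@spread_near q z j) as [k Hk]; [unfold L2; lia|exact Hj0|].
    pose proof (Hx z Lz 0%Z) as H0. unfold between in Hz. fold m in Hk, H0.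
    assert (k = 0 \/ k = 1)%Z as [-> | ->].
    { destruct (Z.lt_trichotomy k 0) as [K|[K|K]]; [|lia|].
      - assert (k * m <= - m)%Z by nia. lia.
      - destruct (Z.eq_dec k 1); [lia|]. assert (2 * m <= k * m)%Z by nia. lia. }
    + lia.
    + lia.
  - exists x. split; [lia|]. split; [intros j Hj; destruct N; eauto|].
    intros z Hz. destruct (Nat.lt_ge_cases L1 (gdist (c z) q)) as [Lz|Lz]; [exact Lz|].
    destruct N. exists z. unfold L2. lia.
Qed.

Lemma evading_start q : exists x, forall q', gdist q q' <= sigma -> evading x q'.
Proof.
  destruct (remote_exists q) as [x Hx]. exists x. intros q' Hq.
  assert (HT : 0 < T) by (destruct T; lia).
  exists x, 0, q. repeat split; try lia; [nia| |exact Hx].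
  intros z Hz. assert (z = x) as -> by (unfold between in Hz; lia).
  destruct (Nat.lt_ge_cases L1 (gdist (c x) q)) as [Lz|Lz]; [exact Lz|].
  assert (Lx : gdist (c x) q <= L2) by (unfold L2; lia).
  specialize (Hx x Lx 0%Z). lia.
Qed.

(** An epoch that is over leaves the robber at its target, remote from all that
    the cop can threaten from its new position, so a new epoch can start. *)
Lemma evading_restart x q : evading x q -> exists tgt rem q0,
  0 < rem <= T /\ (Z.abs (tgt - x) <= Z.of_nat (s * rem))%Z /\
  gdist q0 q <= sigma * (T - rem) /\
  (forall z, between x tgt z -> L1 < gdist (c z) q0) /\ remote L2 tgt q0.
Proof.
  intros (tgt & rem & q0 & H1 & H2 & H3 & H4 & H5).
  destruct rem as [|rem].
  - assert (tgt = x) as -> by lia.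
    destruct (@remote_run x q) as (tgt & B1 & B2 & B3).
    { intros j Hj. apply H5. pose proof (gdist_tri (c j) q q0) as H.
      rewrite (gdist_sym q) in H. unfold L2. rewrite Nat.sub_0_r in H3. lia. }
    assert (0 < T) by (destruct T; lia).
    exists tgt, T, q. rewrite gdist_refl. repeat split; auto; lia.
  - exists tgt, (1 + rem), q0. repeat split; auto; lia.
Qed.

Lemma evading_safe v rad : (forall z, gdist v (c z) <= rad) ->
  safe_region v sigma (b * s) rho (rad + b)
    (fun u q => exists x, u = c x /\ evading x q).
Proof.
  intros Hrad u q (x & -> & Hx). apply evading_restart in Hx.
  destruct Hx as (tgt & rem & q0 & H1 & H2 & H3 & H4 & H5).
  assert (E : exists x', (Z.abs (x' - x) <= Z.of_nat s)%Z /\ between x tgt x' /\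
    (Z.abs (tgt - x') <= Z.of_nat (s * (rem - 1)))%Z).
  { assert (Er : s * rem = s * (rem - 1) + s) by (destruct rem; [lia|]; rewrite Nat.sub_succ, Nat.sub_0_r; lia).
    rewrite Er in H2. clear Er. set (P := s * (rem - 1)) in *.
    unfold between. destruct (Z_le_dec (Z.abs (tgt - x)) (Z.of_nat s)).
    - exists tgt. lia.
    - destruct (Z_le_dec x tgt).
      + exists (x + Z.of_nat s)%Z. lia.
      + exists (x - Z.of_nat s)%Z. lia. }
  destruct E as (x' & X1 & X2 & X3).
  destruct (closed_walk_path X1) as (p & P1 & P2 & P3 & P4).
  exists p. split; [exact P1|]. split; [exact P3|]. split.
  - intros w Hw. destruct (P4 w Hw) as (z & Z1 & Z2).
    assert (B : L1 < gdist (c z) q0) by (apply H4; unfold between in *; lia).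
    pose proof (gdist_tri (c z) w q0). pose proof (gdist_tri w q q0).
    pose proof (gdist_sym w q). pose proof (gdist_sym q q0).
    pose proof (gdist_tri v (c z) w). pose proof (Hrad z).
    assert (sigma * (T - rem) <= sigma * T) by (apply Nat.mul_le_mono_l; lia).
    unfold L1 in B. lia.
  - intros q' Hq. exists x'. split; [exact P2|].
    exists tgt, (rem - 1), q0. repeat split; auto; try lia.
    + pose proof (gdist_tri q0 q q').
      replace (T - (rem - 1)) with (1 + (T - rem)) by lia. lia.
    + intros z Hz. apply H4. unfold between in *. lia.
Qed.

End Evasion.
End ClosedWalk.

(** Every closed walk of length [n >= n0] with steps of length at most [b] has
    two points at distance at least [n / 8] along the walk and at most [n / M] in the
    graph.  A closed walk is a periodic map on the integers. *)
Definition shortcuts (M b n0 : nat) : Prop :=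
  forall (c : Z -> G) n, n0 <= n ->
    (forall z, c (z + Z.of_nat n)%Z = c z) -> (forall z, gdist (c z) (c (z + 1)%Z) <= b) ->
    exists x y : Z, gdist (c x) (c y) * M <= n /\
      forall k, (Z.of_nat n <= 8 * Z.abs (x - y - k * Z.of_nat n))%Z.

(** The order of the quantifiers in the game is what makes this work: the
    robber's speed [b * s] is fixed in terms of [M], [b] and [sigma] only, and the
    reach [rho] is known before the length of the walk has to be large. *)
Theorem shortcuts_of_strong_win (v : G) : strong_cops_win G 1 ->
  forall M b, 1 <= M -> 1 <= b -> exists n0, shortcuts M b n0.
Proof.
  intros Win M b HM Hb. destruct (Win v) as (sigma & Hs & Win1).
  (* With this speed the cop moves about [n / (8 * M)] in the time of a full
     turn, which keeps [2 * L2] below [n / M]. *)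
  set (s := 8 * M * sigma). assert (1 <= s) by (unfold s; nia).
  destruct (Win1 (b * s)) as (rho & _ & Win2); [nia|]. clear Win Win1.
  exists (4 * M * (2 * sigma + rho + b)). intros c n Hn Hp Hc.
  apply NNPP. intros N.
  assert (Hn1 : 4 <= n) by nia.
  destruct (closed_walk_bounded Hp Hc v ltac:(lia)) as [rad Hrad].
  set (T := n / s + 1).
  assert (D : s * (n / s) <= n < s * T).
  { unfold T. pose proof (Nat.div_mod n s). pose proof (Nat.mod_upper_bound n s). lia. }
  set (L := 2 * (sigma * T + (sigma * T + rho + b))).
  assert (HL : L * M <= n) by (unfold L, T, s in *; nia).
  assert (Sp : forall i j, gdist (c i) (c j) <= L ->
    exists k, (8 * Z.abs (i - j - k * Z.of_nat n) < Z.of_nat n)%Z).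
  { intros i j Hij. apply NNPP. intros N'. apply N. exists i, j.
    split; [nia|]. intros k. apply Z.nlt_ge. intros H'. apply N'. eauto. }
  refine (safe_region_escapes _
    (evading_safe Hp Hc Hn1 (Nat.lt_le_incl _ _ (proj2 D)) Sp Hrad) _).
  - intros q. destruct (evading_start Hn1 (Nat.lt_le_incl _ _ (proj2 D)) Sp q) as [x Hx].
    exists (c x). intros q' Hq. exists x. split; [reflexivity|]. exact (Hx q' Hq).
  - apply Win2. lia.
Qed.

End Robber.

(** * Cutting closed walks along shortcuts *)

Section Cutting.
Variable G : graph.
Implicit Types u v w x p : G.

Definition near (b : nat) u w : Prop := gdist u w <= b.

Lemma is_path_nth (V : Type) (e : V -> V -> Prop) (q : list V) (u : V) i :
  is_path e u q -> i < length q -> e (nth i (u :: q) u) (nth (S i) (u :: q) u).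
Proof.
  intros H Hi.
  assert (K : forall d, e (nth i (u :: q) d) (nth (S i) (u :: q) d)); [|apply K].
  intros d. revert u i H Hi. induction q as [|w q IH]; intros u i; simpl length; [lia|].
  intros [Ha Hq] Hi. destruct i as [|i]; [exact Ha|].
  apply (IH w i Hq). lia.
Qed.

Lemma last_firstn (A : Type) (q : list A) (u : A) i :
  i <= length q -> last (firstn i q) u = nth i (u :: q) u.
Proof.
  intros Hi. rewrite last_nth, firstn_length_le by assumption.
  destruct i as [|i]; [reflexivity|]. cbn [nth].
  rewrite <- (firstn_skipn (S i) q) at 2. rewrite app_nth1; [reflexivity|].
  rewrite firstn_length_le; lia.
Qed.

Lemma firstn_add (A : Type) (q : list A) i k :
  firstn (i + k) q = firstn i q ++ firstn k (skipn i q).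
Proof.
  revert q; induction i as [|i IH]; intros q; [reflexivity|].
  destruct q as [|x q]; cbn [Nat.add firstn skipn app].
  - now rewrite firstn_nil.
  - now rewrite IH.
Qed.

(** Shortcuts for closed walks given as lists from a base point: the part [q2]
    between the two ends of a shortcut does not contain the base point in its
    interior. *)
Lemma closed_list_cut M b n0 u q : shortcuts G M b n0 ->
  is_path (near b) u q -> last q u = u -> 1 <= length q -> n0 <= length q ->
  exists q1 q2 q3, q = q1 ++ q2 ++ q3 /\
    length q <= 8 * length q2 <= 7 * length q /\
    gdist (last q1 u) (last q2 (last q1 u)) * M <= length q.
Proof.
  intros SC Hq Hl H1 H0. set (n := length q) in *. set (m := Z.of_nat n).
  set (c := fun z => nth (Z.to_nat (z mod m)) (u :: q) u).
  assert (Bm : forall z, (0 <= z mod m < m)%Z) by (intros z; apply Z.mod_pos_bound; lia).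
  destruct (SC c n H0) as (x & y & Hxy & Hk).
  - intros z. unfold c. fold m. replace (z + m)%Z with (z + 1 * m)%Z by ring.
    now rewrite Z.mod_add by lia.
  - intros z. unfold c. pose proof (Bm z) as Bz.
    destruct (Z_lt_dec (z mod m + 1) m) as [L|L].
    + replace ((z + 1) mod m)%Z with (z mod m + 1)%Z.
      * replace (Z.to_nat (z mod m + 1)) with (S (Z.to_nat (z mod m))) by lia.
        apply (is_path_nth Hq). fold n. lia.
      * apply (Z.mod_unique (z + 1) m (z / m)); [lia|].
        rewrite (Z.div_mod z m) at 1 by lia. ring.
    + replace ((z + 1) mod m)%Z with 0%Z.
      * assert (E : S (Z.to_nat (z mod m)) = length q) by (fold n; lia).
        assert (T := @is_path_nth _ _ _ _ (Z.to_nat (z mod m)) Hq ltac:(fold n; lia)).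
        rewrite E, <- last_nth, Hl in T. exact T.
      * apply (Z.mod_unique (z + 1) m (z / m + 1)); [lia|].
        rewrite (Z.div_mod z m) at 1 by lia. lia.
  - fold m in Hk.
    assert (W : exists i j, i < j < n /\ n <= 8 * (j - i) /\ n <= 8 * (n - (j - i)) /\
              gdist (nth i (u :: q) u) (nth j (u :: q) u) * M <= n).
    { pose proof (Bm x) as Bx. pose proof (Bm y) as By.
      pose proof (Z.div_mod x m ltac:(lia)) as Dx. pose proof (Z.div_mod y m ltac:(lia)) as Dy.
      assert (K : forall l, (m <= 8 * Z.abs (x mod m - y mod m - l * m))%Z).
      { intros l. specialize (Hk (l + x / m - y / m)%Z).
        replace (x - y - (l + x / m - y / m) * m)%Z
          with (x mod m - y mod m - l * m)%Z in Hk; [exact Hk|].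
        rewrite Dx at 2. rewrite Dy at 2. ring. }
      unfold c in Hxy. set (i := (x mod m)%Z) in *. set (j := (y mod m)%Z) in *.
      pose proof (K 0%Z) as K0. pose proof (K 1%Z) as K1. pose proof (K (-1)%Z) as K2.
      destruct (Z_lt_dec i j) as [L|L].
      - exists (Z.to_nat i), (Z.to_nat j). repeat split; auto; lia.
      - exists (Z.to_nat j), (Z.to_nat i). rewrite gdist_sym. repeat split; auto; lia. }
    destruct W as (i & j & Hij & W1 & W2 & W3).
    exists (firstn i q), (firstn (j - i) (skipn i q)), (skipn (j - i) (skipn i q)).
    rewrite !firstn_skipn. split; [reflexivity|].
    rewrite firstn_length_le by (rewrite length_skipn; fold n; lia).
    split; [lia|].
    rewrite <- last_app, <- firstn_add, !last_firstn by (fold n; lia).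
    now replace (i + (j - i)) with j by lia.
Qed.

(** * Descent *)

Section Descent.
Variables (p x0 : G) (D : nat).

(** Near [p], all steps should move away from [x0] by at least 4, a constant
    fraction of the largest step allowed, 13. *)
Definition bad u w : Prop := 2 * gdist p u < D /\ gdist x0 w < gdist x0 u + 4.

Fixpoint nbad (u : G) (q : list G) : nat :=
  match q with
  | [] => 0
  | w :: q' => (if excluded_middle_informative (bad u w) then 1 else 0) + nbad w q'
  end.

Lemma nbad_app u q q' : nbad u (q ++ q') = nbad u q + nbad (last q u) q'.
Proof.
  revert u; induction q as [|w q IH]; intros u; [reflexivity|].
  rewrite last_cons. cbn [app nbad]. rewrite IH. lia.
Qed.

Lemma nbad_le u q : nbad u q <= length q.
Proof.
  revert u; induction q as [|w q IH]; intros u; simpl; [lia|].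
  specialize (IH w). destruct excluded_middle_informative; lia.
Qed.

Lemma near_path_gdist b u q x : is_path (near b) u q -> In x (u :: q) ->
  gdist u x <= b * length q.
Proof.
  revert u; induction q as [|w q IH]; intros u.
  - intros _ [<-|[]]. rewrite gdist_refl. lia.
  - intros [Ha Hq] [<-|Hx]; [rewrite gdist_refl; lia|].
    specialize (IH w Hq Hx). pose proof (gdist_tri u w x). unfold near in Ha.
    simpl length. lia.
Qed.

(** A step that is not bad gains 4 and a bad one loses at most 13. *)
Lemma climb u q : is_path (near 13) u q ->
  (forall x, In x (u :: q) -> 2 * gdist p x < D) ->
  gdist x0 u + 4 * length q <= gdist x0 (last q u) + 17 * nbad u q.
Proof.
  revert u; induction q as [|w q IH]; intros u; [simpl; lia|].
  rewrite last_cons. intros [Ha Hq] Hx.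
  specialize (IH w Hq (fun x H => Hx x (or_intror H))).
  pose proof (Hx u (or_introl eq_refl)). cbn [nbad length].
  pose proof (gdist_tri x0 w u). rewrite (gdist_sym w) in *. unfold near in Ha.
  destruct excluded_middle_informative as [B|B]; unfold bad in B; lia.
Qed.

Lemma adj_path_near b u q : 1 <= b -> is_path adj u q -> is_path (near b) u q.
Proof.
  intros Hb. revert u; induction q as [|w q IH]; intros u; [auto|].
  intros [Ha Hq]. split; [|auto]. apply gdist_adj in Ha. unfold near. lia.
Qed.

(** Replace [q2] by the shortcut, repeatedly.  A cut loses at least [n / 8]
    steps and adds at most [n / M] of them, so [M * nbad + 16 * length] does not
    increase: this sums the geometric series of the lengths of the shortcuts.  As a
    cut keeps at least an eighth of the walk, the first length below [D / 26] is at
    least [D / 208].  All of that walk is within [D / 2] of [p], and [climb]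
    bounds its length by a multiple of the number of its bad steps. *)
Lemma no_climbing_closed_walk M n0 A q : shortcuts G M 13 n0 -> 16 <= M -> 26 * n0 <= D ->
  is_path (near 13) p q -> last q p = p -> 1 <= D <= 208 * length q ->
  M * nbad p q + 16 * length q <= A -> 4 * M * D <= 208 * 17 * A.
Proof.
  intros SC HM Hn0. remember (length q) as n eqn:En.
  revert q En; induction n as [n IH] using (well_founded_induction lt_wf); intros q En Hq Hl HD HA.
  destruct (Nat.lt_ge_cases (26 * n) D) as [L|L].
  - assert (C : gdist x0 p + 4 * length q <= gdist x0 (last q p) + 17 * nbad p q).
    { apply climb; [assumption|]. intros x Hx.
      pose proof (near_path_gdist Hq Hx). lia. }
    rewrite Hl in C. nia.
  - destruct (closed_list_cut (u := p) SC Hq Hl) as (q1 & q2 & q3 & E & H2 & Hd); [lia|lia|].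
    destruct (gdist_path (last q1 p) (last q2 (last q1 p))) as (e & E1 & E2 & E3).
    rewrite <- E3 in Hd. clear E3.
    assert (Ln : n = length q1 + length q2 + length q3) by (rewrite En, E, !length_app; lia).
    rewrite <- En in *.
    rewrite E, !is_path_app in Hq. destruct Hq as (Q1 & Q2 & Q3).
    rewrite E, !last_app in Hl. rewrite E, !nbad_app in HA.
    assert (Le : 16 * length e <= n) by nia.
    apply (IH (length (q1 ++ e ++ q3))) with (q := q1 ++ e ++ q3); rewrite ?length_app; auto.
    + lia.
    + rewrite !is_path_app, E2. repeat split; auto. apply adj_path_near; [lia|assumption].
    + now rewrite !last_app, E2.
    + lia.
    + rewrite !nbad_app, E2. pose proof (nbad_le (last q1 p) e). nia.
Qed.

End Descent.

End Cutting.

(** * Slimness of rough triangles *)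

Section Slim.
Variable G : graph.
Implicit Types u v w x : G.

(** The error 3 comes from replacing the points of a continuous geodesic at
    integer times by vertices at distance at most 1 (error 2), and from its length,
    which need not be an integer (error 1). *)
Definition rough (n : nat) (a : nat -> G) : Prop :=
  forall i j, i <= j <= n ->
    j <= i + gdist (a i) (a j) + 3 /\ gdist (a i) (a j) + i <= j + 3.

(** The bound [N] on the sizes makes a critical [D] exist; the final [D] must
    not depend on it. *)
Definition slim (D N : nat) : Prop :=
  forall (a b c : nat -> G) na nb nc, na <= N -> nb <= N -> nc <= N ->
    rough na a -> rough nb b -> rough nc c ->
    a 0 = c 0 -> a na = b 0 -> b nb = c nc ->
    forall i, i <= nc ->
      (exists j, j <= na /\ gdist (c i) (a j) <= D) \/
      (exists j, j <= nb /\ gdist (c i) (b j) <= D).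

Lemma geod_rough n (a : nat -> G) : geod_fun n a -> rough n a.
Proof. intros H i j Hij. rewrite H by assumption. lia. Qed.

Lemma rough_rev n m (a : nat -> G) : rough n a -> m <= n -> rough m (fun i => a (m - i)).
Proof.
  intros H Hm i j Hij. rewrite gdist_sym. pose proof (H (m - j) (m - i) ltac:(lia)). lia.
Qed.

Lemma rough_shift n k (a : nat -> G) : rough n a -> k <= n -> rough (n - k) (fun i => a (k + i)).
Proof. intros H Hk i j Hij. pose proof (H (k + i) (k + j) ltac:(lia)). lia. Qed.

Lemma slim_trivial N : slim (N + 3) N.
Proof.
  intros a b c na nb nc Na Nb Nc _ _ Rc Eac _ _ i Hi. left. exists 0. split; [lia|].
  rewrite Eac, gdist_sym. pose proof (Rc 0 i ltac:(lia)). lia.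
Qed.

Lemma slim_threshold D N : ~ slim D N -> exists D', D <= D' /\ ~ slim D' N /\ slim (S D') N.
Proof.
  intros H. apply NNPP. intros C.
  assert (K : forall k, ~ slim (D + k) N).
  { induction k as [|k IH]; [now rewrite Nat.add_0_r|]. intros B. apply C.
    exists (D + k). repeat split; [lia|exact IH|now rewrite <- Nat.add_succ_r]. }
  apply (K (N + 3)).
  intros a b c na nb nc Na Nb Nc Ra Rb Rc E1 E2 E3 i Hi.
  destruct (slim_trivial Na Nb Nc Ra Rb Rc E1 E2 E3 Hi) as [(j & J1 & J2)|(j & J1 & J2)];
    [left|right]; exists j; lia.
Qed.

(** Walks inside [F], which will be the vertices not too close to [p]; there
    no step is bad. *)
Section Detour.
Variable F : G -> Prop.

Definition detour (u w : G) (l : nat) : Prop :=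
  exists q, is_path (near 13) u q /\ last q u = w /\ length q <= l /\
    forall x, In x (u :: q) -> F x.

Lemma detour_trans u v w l l' : detour u v l -> detour v w l' -> detour u w (l + l').
Proof.
  intros (q & Q1 & Q2 & Q3 & Q4) (r & R1 & R2 & R3 & R4). exists (q ++ r).
  rewrite is_path_app, last_app, length_app, Q2. repeat split; auto; [lia|].
  intros x [Hx|Hx]; [apply Q4; now left|]. apply in_app_or in Hx.
  destruct Hx as [Hx|Hx]; [apply Q4; now right|apply R4; now right].
Qed.

Lemma detour_le u w l l' : detour u w l -> l <= l' -> detour u w l'.
Proof. intros (q & Q1 & Q2 & Q3 & Q4) H. exists q. repeat split; auto; lia. Qed.

Lemma detour_refl u : F u -> detour u u 0.
Proof. intros H. exists []. repeat split; auto. now intros x [<-|[]]. Qed.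

Lemma detour_step u w : gdist u w <= 13 -> F u -> F w -> detour u w 1.
Proof.
  intros H Hu Hw. exists [w]. repeat split; auto. now intros x [<-|[<-|[]]].
Qed.

Lemma detour_sym u w l : detour u w l -> detour w u l.
Proof.
  intros (q & Q1 & Q2 & Q3 & Q4). apply detour_le with (2 := Q3). clear Q3 l.
  revert u Q1 Q2 Q4; induction q as [|v q IH]; intros u Q1 Q2 Q4.
  - simpl in Q2; subst w. apply detour_refl. apply Q4. now left.
  - rewrite last_cons in Q2. destruct Q1 as [Ha Q1].
    simpl length. rewrite <- Nat.add_1_r. apply detour_trans with v.
    + apply IH; auto. intros x Hx. apply Q4. now right.
    + apply detour_step; [unfold near in Ha; now rewrite gdist_sym|apply Q4; right; now left|].
      apply Q4. now left.
Qed.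

Lemma detour_geodesic u w l : gdist u w <= l ->
  (forall x, gdist u x + gdist x w <= l -> F x) -> detour u w l.
Proof.
  intros Hl H. destruct (gdist_path u w) as (q & Q1 & Q2 & Q3).
  exists q. repeat split; auto; [apply adj_path_near; [lia|assumption]|lia|].
  intros x Hx. apply H.
  apply (In_nth _ _ u) in Hx. destruct Hx as (i & Hi & <-). simpl length in Hi.
  pose proof (path_gdist_nth (i := 0) (j := i) Q1 ltac:(lia)) as H1.
  pose proof (path_gdist_nth (i := i) (j := length q) Q1 ltac:(lia)) as H2.
  rewrite <- last_nth, Q2 in H2. change (nth 0 (u :: q) u) with u in H1. lia.
Qed.

Lemma detour_rough n (a : nat -> G) : rough n a -> (forall j, j <= n -> F (a j)) ->
  forall i j, i <= n -> j <= n -> detour (a i) (a j) (i - j + (j - i)).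
Proof.
  intros R H.
  assert (K : forall i k, i + k <= n -> detour (a i) (a (i + k)) k).
  { intros i k; induction k as [|k IH]; intros Hk.
    - rewrite Nat.add_0_r. apply detour_refl, H. lia.
    - rewrite <- (Nat.add_1_r k). apply detour_trans with (a (i + k)); [apply IH; lia|].
      apply detour_step; [|apply H; lia|apply H; lia].
      pose proof (R (i + k) (i + (k + 1)) ltac:(lia)). lia. }
  intros i j Hi Hj. destruct (Nat.le_ge_cases i j) as [L|L].
  - replace j with (i + (j - i)) at 1 by lia. apply detour_le with (1 := K i (j - i) ltac:(lia)). lia.
  - apply detour_sym. replace i with (j + (i - j)) at 1 by lia.
    apply detour_le with (1 := K j (i - j) ltac:(lia)). lia.
Qed.

End Detour.

(** A triangle of size at most [N] with a point [p] at distance more than [D]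
    from two of its sides, where all triangles of this size are [D + 1]-slim. *)
Section Thick.
Variables (N D : nat) (a b c : nat -> G) (na nb nc i0 : nat).
Hypothesis D_large : 100 <= D.
Hypothesis slim_SD : slim (S D) N.
Hypotheses (na_le : na <= N) (nb_le : nb <= N) (nc_le : nc <= N).
Hypotheses (rough_a : rough na a) (rough_b : rough nb b) (rough_c : rough nc c).
Hypotheses (ac : a 0 = c 0) (ab : a na = b 0) (bc : b nb = c nc).
Hypothesis i0_le : i0 <= nc.
Let p := c i0.
Hypothesis thick_a : forall j, j <= na -> D < gdist p (a j).
Hypothesis thick_b : forall j, j <= nb -> D < gdist p (b j).

Definition far x : Prop := D <= 2 * gdist p x.

Definition side x : Prop := (exists j, j <= na /\ x = a j) \/ (exists j, j <= nb /\ x = b j).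

Lemma side_thick x : side x -> D < gdist p x.
Proof. intros [(j & Hj & ->)|(j & Hj & ->)]; auto. Qed.

Lemma far_a j : j <= na -> far (a j).
Proof. intros H. apply thick_a in H. unfold far. lia. Qed.

Lemma far_b j : j <= nb -> far (b j).
Proof. intros H. apply thick_b in H. unfold far. lia. Qed.

(** To pass from one side to the other without going all the way to the corner
    [a na], follow the first side for [30 * D].  The triangle that is cut off by a
    geodesic [e] from [a j1] to [b j2] again has size at most [N], so it is
    [D + 1]-slim, and the point reached is too far from [e]; hence it is within
    [D + 1] of the other side.  A path of length [D + 1] between two points farther
    than [D] from [p] stays at distance at least [D / 2]. *)
Lemma detour_two_sides j1 j2 : j1 <= na -> j2 <= nb -> gdist (a j1) (b j2) <= 23 * D ->
  detour far (a j1) (b j2) (87 * D).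
Proof.
  intros H1 H2 E. destruct (Nat.le_gt_cases (na - j1) (30 * D)) as [L|L].
  - assert (Y : detour far (a j1) (b 0) (30 * D)).
    { rewrite <- ab. apply detour_le with (1 := detour_rough rough_a far_a H1 (le_n na)). lia. }
    apply detour_le with (30 * D + 54 * D); [|lia]. apply detour_trans with (1 := Y).
    apply detour_le with (1 := detour_rough rough_b far_b (Nat.le_0_l nb) H2).
    pose proof (rough_b (i := 0) (j := j2) ltac:(lia)).
    pose proof (rough_a (i := j1) (j := na) ltac:(lia)). rewrite ab in *.
    pose proof (gdist_tri (b 0) (a j1) (b j2)). rewrite (gdist_sym (b 0) (a j1)) in *. lia.
  - destruct (geodesic_exists (a j1) (b j2)) as (e & e0 & e1 & He).
    set (m := gdist (a j1) (b j2)) in *.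
    pose proof (rough_a (i := j1) (j := j1 + 30 * D) ltac:(lia)) as R1.
    destruct (slim_SD (a := e) (b := fun i => b (j2 - i)) (c := fun i => a (j1 + i))
       (na := m) (nb := j2) (nc := na - j1)) with (i := 30 * D) as [(k & K1 & K2)|(k & K1 & K2)];
       try lia.
    + now apply geod_rough.
    + now apply rough_rev with nb.
    + now apply rough_shift.
    + now rewrite Nat.add_0_r.
    + now rewrite Nat.sub_0_r.
    + rewrite Nat.sub_diag, <- ab. f_equal. lia.
    + exfalso. pose proof (He 0 k ltac:(lia)) as Hk. rewrite e0 in Hk.
      pose proof (gdist_tri (a j1) (e k) (a (j1 + 30 * D))).
      rewrite (gdist_sym (e k)) in *. lia.
    + set (t := a (j1 + 30 * D)) in *. set (j3 := j2 - k) in *.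
      assert (T1 : detour far (a j1) t (30 * D)).
      { apply detour_le with (1 := detour_rough rough_a far_a H1 (j := j1 + 30 * D) ltac:(lia)). lia. }
      assert (T2 : detour far t (b j3) (S D)).
      { apply detour_geodesic; [assumption|]. intros x Hx.
        pose proof (thick_a (j := j1 + 30 * D) ltac:(lia)) as A1. fold t in A1.
        pose proof (thick_b (j := j3) ltac:(lia)) as A2.
        pose proof (gdist_tri p x t). pose proof (gdist_tri p x (b j3)).
        rewrite (gdist_sym x t) in *. unfold far. lia. }
      assert (T3 : detour far (b j3) (b j2) (55 * D)).
      { apply detour_le with (1 := detour_rough rough_b far_b (i := j3) (j := j2) ltac:(lia) H2).
        pose proof (rough_b (i := j3) (j := j2) ltac:(lia)).
        pose proof (gdist_tri (b j3) t (b j2)). pose proof (gdist_tri t (a j1) (b j2)).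
        rewrite (gdist_sym (b j3) t), (gdist_sym t (a j1)) in *. lia. }
      apply detour_le with (1 := detour_trans (detour_trans T1 T2) T3). lia.
Qed.

Lemma detour_sides x y : side x -> side y -> gdist x y <= 23 * D -> detour far x y (87 * D).
Proof.
  intros [(i & Hi & ->)|(i & Hi & ->)] [(j & Hj & ->)|(j & Hj & ->)] E.
  - apply detour_le with (1 := detour_rough rough_a far_a Hi Hj).
    destruct (Nat.le_ge_cases i j).
    + pose proof (rough_a (i := i) (j := j) ltac:(lia)). lia.
    + pose proof (rough_a (i := j) (j := i) ltac:(lia)). rewrite gdist_sym in E. lia.
  - now apply detour_two_sides.
  - apply detour_sym. rewrite gdist_sym in E. now apply detour_two_sides.
  - apply detour_le with (1 := detour_rough rough_b far_b Hi Hj).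
    destruct (Nat.le_ge_cases i j).
    + pose proof (rough_b (i := i) (j := j) ltac:(lia)). lia.
    + pose proof (rough_b (i := j) (j := i) ltac:(lia)). rewrite gdist_sym in E. lia.
Qed.

(** Near its ends the third side is close to a corner of the triangle;
    elsewhere slimness applies.  Since [c i] is far from [p], or close to a corner,
    the short connecting path avoids [p]. *)
Lemma detour_to_side i : i <= nc -> i < 10 \/ nc - i < 10 \/ 10 * D <= i - i0 + (i0 - i) ->
  exists x, side x /\ gdist (c i) x <= S D /\ detour far (c i) x (S D).
Proof.
  intros Hi H.
  assert (K : forall x, side x -> gdist (c i) x <= 12 -> detour far (c i) x (S D)).
  { intros x Sx Lx. apply detour_le with 12; [|lia]. apply detour_geodesic; [exact Lx|].
    intros y Hy. apply side_thick in Sx. pose proof (gdist_tri p y x). unfold far. lia. }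
  destruct H as [H|[H|H]].
  - assert (Sx : side (a 0)) by (left; exists 0; split; [lia|reflexivity]).
    assert (L : gdist (c i) (a 0) <= 12).
    { rewrite ac, gdist_sym. pose proof (rough_c (i := 0) (j := i) ltac:(lia)). lia. }
    exists (a 0). repeat split; auto. lia.
  - assert (Sx : side (b nb)) by (right; exists nb; split; [lia|reflexivity]).
    assert (L : gdist (c i) (b nb) <= 12).
    { rewrite bc. pose proof (rough_c (i := i) (j := nc) ltac:(lia)). lia. }
    exists (b nb). repeat split; auto. lia.
  - assert (P : 10 * D <= gdist p (c i) + 3).
    { destruct (Nat.le_ge_cases i i0).
      - pose proof (rough_c (i := i) (j := i0) ltac:(lia)). unfold p. rewrite gdist_sym. lia.
      - pose proof (rough_c (i := i0) (j := i) ltac:(lia)). unfold p. lia. }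
    assert (E : exists x, side x /\ gdist (c i) x <= S D).
    { destruct (slim_SD na_le nb_le nc_le rough_a rough_b rough_c ac ab bc Hi)
        as [(j & J1 & J2)|(j & J1 & J2)].
      - exists (a j). split; [left; eauto|exact J2].
      - exists (b j). split; [right; eauto|exact J2]. }
    destruct E as (x & Sx & Lx). exists x. repeat split; auto.
    apply detour_geodesic; [exact Lx|]. intros y Hy.
    pose proof (gdist_tri p y (c i)). rewrite (gdist_sym y) in *. unfold far. lia.
Qed.

Lemma detour_nbad x0 u w l : detour far u w l ->
  exists q, is_path (near 13) u q /\ last q u = w /\ length q <= l /\ nbad p x0 D u q = 0.
Proof.
  intros (q & Q1 & Q2 & Q3 & Q4). exists q. repeat split; auto. clear Q1 Q2 Q3.
  revert u Q4; induction q as [|v q IH]; intros u Q4; [reflexivity|].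
  cbn [nbad]. rewrite IH by (intros x Hx; apply Q4; now right).
  destruct excluded_middle_informative as [[B _]|_]; [|reflexivity].
  specialize (Q4 u (or_introl eq_refl)). unfold far in Q4. lia.
Qed.

(** Moving along [c] in steps of 10 makes the progress of each step exceed the
    errors of a rough geodesic: the distance to [c i1] grows by at least
    [10 - 2 * 3 = 4], and the steps have length at most [10 + 3 = 13]. *)
Lemma climbing_walk i1 i m : i1 <= i -> i + 10 * m <= nc ->
  exists q, is_path (near 13) (c i) q /\ last q (c i) = c (i + 10 * m) /\ length q = m /\
    nbad p (c i1) D (c i) q = 0.
Proof.
  revert i; induction m as [|m IH]; intros i Hi Hm.
  - exists []. rewrite Nat.add_0_r. repeat split; auto.
  - destruct (IH (i + 10)) as (q & Q1 & Q2 & Q3 & Q4); [lia|lia|].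
    exists (c (i + 10) :: q). rewrite last_cons, Q2. cbn [is_path length nbad]. rewrite Q3, Q4.
    pose proof (rough_c (i := i) (j := i + 10) ltac:(lia)).
    pose proof (rough_c (i := i1) (j := i) ltac:(lia)).
    pose proof (rough_c (i := i1) (j := i + 10) ltac:(lia)).
    repeat split; auto; [unfold near; lia|f_equal; lia|].
    destruct excluded_middle_informative as [[_ B]|_]; [lia|reflexivity].
Qed.

(** Follow [c] from [p] for about [10 * D] or to its end, go over to the sides,
    around along the sides, back to [c] before [p], and along [c] to [p]. *)
Lemma thick_closed_walk : exists x0 q, is_path (near 13) p q /\ last q p = p /\
  length q <= 92 * D /\ D <= 13 * length q /\ nbad p x0 D p q = 0.
Proof.
  set (m1 := Nat.min D (i0 / 10)). set (m2 := Nat.min D ((nc - i0) / 10)).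
  pose proof (Nat.div_mod i0 10 ltac:(lia)). pose proof (Nat.mod_upper_bound i0 10 ltac:(lia)).
  pose proof (Nat.div_mod (nc - i0) 10 ltac:(lia)). pose proof (Nat.mod_upper_bound (nc - i0) 10 ltac:(lia)).
  set (i1 := i0 - 10 * m1). set (i2 := i0 + 10 * m2).
  destruct (@detour_to_side i1) as (x & Sx & Lx & Dx); [lia|lia|].
  destruct (@detour_to_side i2) as (z & Sz & Lz & Dz); [lia|lia|].
  assert (Lxz : gdist z x <= 23 * D).
  { pose proof (rough_c (i := i1) (j := i2) ltac:(lia)).
    pose proof (gdist_tri z (c i2) x). pose proof (gdist_tri (c i2) (c i1) x).
    rewrite (gdist_sym z (c i2)), (gdist_sym (c i2) (c i1)) in *. lia. }
  pose proof (detour_sides Sz Sx Lxz) as Dzx.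
  destruct (detour_nbad (c i1) Dz) as (q2 & A1 & A2 & A3 & A4).
  destruct (detour_nbad (c i1) Dzx) as (q3 & B1 & B2 & B3 & B4).
  destruct (detour_nbad (c i1) (detour_sym Dx)) as (q4 & C1 & C2 & C3 & C4).
  destruct (@climbing_walk i1 i0 m2) as (q1 & D1 & D2 & D3 & D4); [lia|lia|].
  destruct (@climbing_walk i1 i1 m1) as (q5 & E1 & E2 & E3 & E4); [lia|lia|].
  replace (i1 + 10 * m1) with i0 in E2 by lia.
  fold i2 in D2. fold p in D1, D2, D4, E2.
  assert (Q : is_path (near 13) p (q1 ++ q2 ++ q3 ++ q4 ++ q5)).
  { rewrite !is_path_app, D2, A2, B2, C2. auto. }
  exists (c i1), (q1 ++ q2 ++ q3 ++ q4 ++ q5).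
  repeat split.
  - exact Q.
  - now rewrite !last_app, D2, A2, B2, C2.
  - rewrite !length_app. lia.
  - apply Nat.le_trans with (gdist p z); [apply side_thick in Sz; lia|].
    apply (near_path_gdist Q). replace z with (last (q1 ++ q2) p) by now rewrite last_app, D2.
    destruct (last_in (q1 ++ q2) p) as [W|W]; [left; exact W|right].
    rewrite app_assoc. apply in_or_app. now left.
  - rewrite !nbad_app, D2, A2, B2, C2. lia.
Qed.

End Thick.

Theorem slim_of_shortcuts : (forall M b, 1 <= M -> 1 <= b -> exists n0, shortcuts G M b n0) ->
  exists D, forall N, slim D N.
Proof.
  (* [M] must exceed [52 * 17 * 16 * 92], where [52 = 208 / 4]. *)
  intros SC. destruct (SC (1000 * 2000) 13) as [n0 Hn0]; [lia|lia|].
  (* A walk that is still to be cut has length at least [D / 26 >= n0]. *)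
  exists (26 * n0 + 100). intros N. apply NNPP. intros NS.
  destruct (slim_threshold NS) as (D & HD & ND & SD). apply ND.
  intros a b c na nb nc Na Nb Nc Ra Rb Rc Eac Eab Ebc i Hi. apply NNPP. intros H.
  destruct (@thick_closed_walk N D a b c na nb nc i) as (x0 & q & Q1 & Q2 & Q3 & Q4 & Q5); auto.
  - lia.
  - intros j Hj. apply Nat.nle_gt. intros L. apply H. left. eauto.
  - intros j Hj. apply Nat.nle_gt. intros L. apply H. right. eauto.
  - assert (K := no_climbing_closed_walk (A := 16 * (92 * D)) (x0 := x0) (D := D) Hn0
      ltac:(lia) ltac:(lia) Q1 Q2 ltac:(lia) ltac:(lia)). lia.
Qed.

End Slim.

(** * From rough triangles to triangles of the realization *)

Section Transfer.
Variable G : graph.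
Local Open Scope R_scope.

Definition nearest (x : point G) : G :=
  proj1_sig (constructive_indefinite_description _ (vertex_near_point x)).

Lemma nearestP x : length_dist x (vertex_point G (nearest x)) <= 1.
Proof. exact (proj2_sig (constructive_indefinite_description _ (vertex_near_point x))). Qed.

(** Sampling at the times [min i L], where [L] is the length, makes the ends of
    the sample depend on the ends of the geodesic only, so that the samples of the
    sides of a triangle fit together. *)
Lemma geodesic_sample (x y : point G) g : geodesic (realization G) x y g ->
  exists n a, a 0%nat = nearest x /\ a n = nearest y /\ rough n a /\
    (forall i, (i <= n)%nat -> exists t, 0 <= t <= length_dist x y /\
       length_dist (vertex_point G (a i)) (g t) <= 1) /\
    (forall s, 0 <= s <= length_dist x y -> exists i, (i <= n)%nat /\
       length_dist (g s) (vertex_point G (a i)) <= 2).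
Proof.
  intros (g0 & g1 & Hg). simpl in g1, Hg. set (L := length_dist x y) in *.
  assert (HL : 0 <= L) by apply Rge_le, length_dist_pos.
  destruct (nfloor_ex L HL) as (m & M1 & M2).
  set (f := fun i => Rmin (INR i) L).
  assert (fB : forall i, 0 <= f i <= L).
  { intros i. pose proof (pos_INR i). unfold f, Rmin. destruct Rle_dec; lra. }
  assert (fi : forall i, (i <= m)%nat -> f i = INR i).
  { intros i Hi. apply le_INR in Hi. apply Rmin_left. lra. }
  assert (fm : f (S m) = L) by (apply Rmin_right; rewrite S_INR; lra).
  assert (fd : forall i j, (i <= j <= S m)%nat -> INR j - INR i - 1 <= f j - f i <= INR j - INR i).
  { intros i j Hij. destruct (Nat.eq_dec j (S m)) as [->|Nj].
    - destruct (Nat.eq_dec i (S m)) as [->|Ni]; [lra|].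
      rewrite fm, fi, S_INR by lia. lra.
    - rewrite !fi by lia. lra. }
  exists (S m), (fun i => nearest (g (f i))). repeat split.
  - f_equal. rewrite fi by lia. exact g0.
  - f_equal. now rewrite fm.
  - pose proof (fd i j H) as F.
    pose proof (length_dist_tri (g (f i)) (g (f j)) (vertex_point G (nearest (g (f i))))) as T1.
    pose proof (length_dist_tri (vertex_point G (nearest (g (f i)))) (g (f j))
      (vertex_point G (nearest (g (f j))))) as T2.
    rewrite (length_dist_sym (vertex_point G (nearest (g (f j)))) (g (f j))),
      length_dist_vertices in T2.
    pose proof (nearestP (g (f i))). pose proof (nearestP (g (f j))).
    rewrite Hg, Rabs_minus_sym in T1 by auto.
    pose proof (Rle_abs (f j - f i)).
    apply INR_le. rewrite !plus_INR. simpl (INR 3). lra.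
  - pose proof (fd i j H) as F.
    pose proof (length_dist_tri (vertex_point G (nearest (g (f i))))
      (vertex_point G (nearest (g (f j)))) (g (f i))) as T1.
    pose proof (length_dist_tri (g (f i)) (vertex_point G (nearest (g (f j)))) (g (f j))) as T2.
    rewrite (length_dist_sym _ (g (f i))), length_dist_vertices in T1.
    pose proof (nearestP (g (f i))). pose proof (nearestP (g (f j))).
    rewrite Hg, Rabs_minus_sym in T2 by auto.
    assert (Rabs (f j - f i) <= INR j - INR i).
    { apply Rabs_le. assert (INR i <= INR j) by (apply le_INR; lia).
      destruct (Nat.eq_dec i j) as [->|Nij]; [lra|].
      assert (INR i + 1 <= INR j) by (rewrite <- S_INR; apply le_INR; lia). lra. }
    apply INR_le. rewrite !plus_INR. simpl (INR 3). lra.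
  - intros i Hi. exists (f i). split; [apply fB|]. rewrite length_dist_sym. apply nearestP.
  - intros s Hs. destruct (nfloor_ex s (proj1 Hs)) as (i & I1 & I2).
    assert (Hi : (i <= m)%nat).
    { apply Nat.lt_succ_r, INR_lt. rewrite S_INR. lra. }
    exists i. split; [lia|]. rewrite fi by assumption.
    pose proof (length_dist_tri (g s) (vertex_point G (nearest (g (INR i)))) (g (INR i))) as T.
    pose proof (nearestP (g (INR i))).
    rewrite Hg in T; [|exact Hs|split; [apply pos_INR|lra]].
    rewrite Rabs_pos_eq in T by lra. lra.
Qed.

Lemma hyperbolic_of_slim : (exists D, forall N, slim G D N) -> hyperbolic_graph G.
Proof.
  intros [D HD]. exists (INR D + 3). intros x y z gxy gyz gxz Hxy Hyz Hxz s Hs.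
  destruct (geodesic_sample Hxy) as (na & a & A0 & A1 & Ra & Ta & _).
  destruct (geodesic_sample Hyz) as (nb & b & B0 & B1 & Rb & Tb & _).
  destruct (geodesic_sample Hxz) as (nc & c & C0 & C1 & Rc & _ & Sc).
  destruct (Sc s Hs) as (i & Hi & Di).
  unfold near_geodesic. simpl.
  assert (K : forall (w : G) q, (gdist (c i) w <= D)%nat ->
    length_dist (vertex_point G w) q <= 1 -> length_dist (gxz s) q <= INR D + 3).
  { intros w q Hw Hq. apply le_INR in Hw. rewrite <- length_dist_vertices in Hw.
    pose proof (length_dist_tri (gxz s) q (vertex_point G (c i))).
    pose proof (length_dist_tri (vertex_point G (c i)) q (vertex_point G w)). lra. }
  destruct (HD (na + nb + nc)%nat a b c na nb nc) with (i := i) as [(j & J1 & J2)|(j & J1 & J2)];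
    try lia; auto; try congruence.
  - left. destruct (Ta j J1) as (t & Ht & Dt). eauto.
  - right. destruct (Tb j J1) as (t & Ht & Dt). eauto.
Qed.

Theorem cop_wins_hyperbolic : strong_cops_win G 1 -> hyperbolic_graph G.
Proof.
  intros W. destruct (classic (inhabited G)) as [[v]|N].
  - apply hyperbolic_of_slim, slim_of_shortcuts. exact (shortcuts_of_strong_win v W).
  - exists 0. intros x. destruct N. exact (inhabits (nearest x)).
Qed.

End Transfer.

Theorem theorem3p4 : forall G : graph,
  hyperbolic_graph G <-> sCop G = Finite 1%R.
Proof.
  intros G. rewrite sCop_eq1. split.
  - apply hyperbolic_cop_wins.
  - apply cop_wins_hyperbolic.
Qed.
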